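(* Let $m,n\in\mathbb{Z}$ with $m\ge 0$ and $m+n\le 0$, and let $\mu,\nu\ge 0$ be determined by the cases below. Then: - if $m=n=0$: $\mathfrak{S}(q_{0,0})=\hat z_-$; - if $m=2\mu$, $n=-2\mu-2\nu$ with $\mu\ge1$: $\mathfrak{S}(q_{m,n}) = (z_+\,p_+\,p_-\,z_-)^{\nu}\,(p_-\,z_-)^{\mu-1}\,p_-\,\hat{z}_-\,p_-\,(z_-\,p_-)^{\mu-1}\,(z_-\,p_-\,p_+\,z_+)^{\nu}$; - if $m=2\mu$, $n=-2\mu-2\nu$ with $\nu\ge1$: $\mathfrak{S}(q_{m,n}) = (z_+\,p_+\,p_-\,z_-)^{\nu-1}\,z_+\,p_+\,(p_-\,z_-)^{\mu}\,p_-\,\hat{z}_-\,p_-\,(z_-\,p_-)^{\mu}\,p_+\,z_+\,(z_-\,p_-\,p_+\,z_+)^{\nu-1}$; - if $m=2\mu$, $n=-2\mu-2\nu-1$: $\mathfrak{S}(q_{m,n}) = (z_+\,p_+\,p_-\,z_-)^{\nu}\,(z_+\,p_+)^{\mu}\,z_+\,\hat{p}_+\,z_+\,(p_+\,z_+)^{\mu}\,(z_-\,p_-\,p_+\,z_+)^{\nu}$; - if $m=2\mu+1$, $n=-2\mu-2\nu$ (so $\nu\ge1$): $\mathfrak{S}(q_{m,n}) = (z_+\,p_+\,p_-\,z_-)^{\nu-1}\,(z_+\,p_+)^{\mu+1}\,\hat{z}_+\,(p_+\,z_+)^{\mu+1}\,(z_-\,p_-\,p_+\,z_+)^{\nu-1}$;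 - if $m=2\mu+1$, $n=-2\mu-2\nu-1$: $\mathfrak{S}(q_{m,n}) = (z_+\,p_+\,p_-\,z_-)^{\nu}\,(p_-\,z_-)^{\mu}\,\hat{p}_-\,(z_-\,p_-)^{\mu}\,(z_-\,p_-\,p_+\,z_+)^{\nu}$.
   Context: For real parameters $a=(a_0,a_1,a_2)$ with $a_0+a_1+a_2=1$, $a_1\neq 0$, the fourth Painlevé equation $P_{IV}$ is $q''=\frac{(q')^2}{2q}+\frac32 q^3+4tq^2+2(t^2+a_2-a_0)q-\frac{2a_1^2}{q}$. Poles of a solution are simple with residue $\pm1$: residue $+1$ is a plus pole ($p_+$), residue $-1$ a minus pole ($p_-$). Zeros are simple with $q(t)=2\epsilon a_1(t-t_* )+O((t-t_* )^2)$, $\epsilon\in\{\pm1\}$: $\epsilon=+1$ a plus zero ($z_+$), $\epsilon=-1$ a minus zero ($z_-$). The generalised Okamoto polynomials $Q_{m,n}(t)$ are defined by $Q_{m,n-1}Q_{m,n+1}=\frac92(Q_{m,n}''Q_{m,n}-(Q_{m,n}')^2)+(2t^2+3(m+2n+1))Q_{m,n}^2$, $Q_{m+1,n}Q_{m-1,n}=\frac92(Q_{m,n}''Q_{m,n}-(Q_{m,n}')^2)+(2t^2+3(-2m+n-1))Q_{m,n}^2$, with $Q_{0,0}=Q_{-1,0}=Q_{0,-1}=1$, $Q_{-1,-1}=\sqrt2\,t$. The generalised Okamoto rational $q_{m,n}=-\frac23 t+\frac{d}{dt}\log\frac{Q_{m-1,n}}{Q_{m,n}}$ solves $P_{IV}$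 with $a=(\frac13-m-n,\frac13+n,\frac13+m)$. For a real solution $q$ with real zeros/poles $t_1<\dots<t_N$, the singularity signature $\mathfrak{S}(q)$ is the word $s_1\cdots s_N$, $s_i\in\{z_+,z_-,p_+,p_-\}$ the type at $t_i$; $(w)^k$ is $k$-fold repetition ($(w)^0$ empty), and $\hat s$ marks the letter at $t=0$.
   Formalization: The constant in the second recurrence for Q_{m,n}, printed as 3(-2m+n-1), is corrected to 3(-2m-n-1); as printed it gives Q_{1,-1}·√2 t = 2t²-6, so Q_{1,-1} is not a polynomial and the claimed signature of q_{1,-1} fails. *)

(* Defs.v *)
From HB Require Import structures.
From mathcomp Require Import all_boot all_order all_algebra.
Set Implicit Arguments. Unset Strict Implicit. Unset Printing Implicit Defensive.
Import Order.TTheory GRing.Theory Num.Theory.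
Local Open Scope ring_scope.

Section Okamoto.
Variable R : rcfType.

Definition todaRHS (c : R) (p : {poly R}) : {poly R} :=
  (9%:R / 2%:R) *: (p^`()^`() * p - p^`() ^+ 2)
  + (2%:R *: 'X^2 + c%:P) * p ^+ 2.

(* Columns m = -1 and m = 0, going down in n:
   colpair m k = (Q_{m,-k}, Q_{m,-k-1}), using the first recurrence at n = -k-1:
   Q_{m,n-1} = todaRHS (3(m+2n+1)) Q_{m,n} / Q_{m,n+1}. *)
Definition col_init (m : int) : {poly R} * {poly R} :=
  if m == 0 then (1, 1)                       (* Q_{0,0}, Q_{0,-1} *)
  else (1, (Num.sqrt (2%:R : R)) *: 'X).      (* Q_{-1,0}, Q_{-1,-1} *)

Fixpoint colpair (m : int) (k : nat) : {poly R} * {poly R} :=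
  match k with
  | 0%N => col_init m
  | k'.+1 =>
      let (a, b) := colpair m k' in
      let n : int := - (k'.+1 : int) in
      (b, todaRHS ((3 * (m + 2 * n + 1))%:~R) b %/ a)
  end.

(* Going up in m at fixed n = -k (second recurrence at index i):
   Q_{i+1,n} = todaRHS (3(-2i-n-1)) Q_{i,n} / Q_{i-1,n}.
   NOTE: the source prints the constant as 3(-2m+n-1); with that constant the
   recurrences are inconsistent with the initial data (e.g. Q_{1,-1} Q_{-1,-1}
   = 2t^2-6 is not divisible by sqrt2 t), while 3(-2m-n-1) gives polynomials
   and q_{m,n} solving P_IV with a = (1/3-m-n, 1/3+n, 1/3+m). *)
Fixpoint mpair (k : nat) (i : nat) : {poly R} * {poly R} :=
  match i with
  | 0%N => ((colpair (-1) k).1, (colpair 0 k).1)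
  | i'.+1 =>
      let (a, b) := mpair k i' in
      let n : int := - (k : int) in
      (b, todaRHS ((3 * (- 2 * (i' : int) - n - 1))%:~R) b %/ a)
  end.

(* Generalised Okamoto polynomial Q_{m,n}, for m >= -1 and n <= 0
   (the only range used below). *)
Definition okamotoQ (m n : int) : {poly R} :=
  if m < 0 then (colpair (-1) `|n|%N).1 else (mpair `|n|%N `|m|%N).2.

(* The generalised Okamoto rational solution
     q_{m,n} = -2/3 t + d/dt log (Q_{m-1,n} / Q_{m,n})
             = -2/3 t + Q_{m-1,n}'/Q_{m-1,n} - Q_{m,n}'/Q_{m,n},
   represented as the quotient  qnum / qden  of two polynomials. *)
Definition qden (m n : int) : {poly R} := okamotoQ (m - 1) n * okamotoQ m n.
Definition qnum (m n : int) : {poly R} :=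
  - ((2%:R / 3%:R) *: 'X) * qden m n
  + (okamotoQ (m - 1) n)^`() * okamotoQ m n
  - (okamotoQ m n)^`() * okamotoQ (m - 1) n.

(* Local behaviour of the rational function N/D at x:
   N/D = lc * (t - x)^ord * (1 + O(t - x)). *)
Definition rord (N D : {poly R}) (x : R) : int :=
  (mup x N)%:Z - (mup x D)%:Z.
Definition rlc (N D : {poly R}) (x : R) : R :=
  (N %/ ('X - x%:P) ^+ mup x N).[x] / (D %/ ('X - x%:P) ^+ mup x D).[x].

Inductive sing := zplus | zminus | pplus | pminus.

(* Type of N/D at x, for the P_IV parameter a1:
   z_eps : q = 2 eps a1 (t - x) + O((t-x)^2);
   p_eps : simple pole with residue eps. *)
Definition has_type (a1 : R) (N D : {poly R}) (x : R) (s : sing) : Prop :=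
  match s with
  | zplus  => rord N D x = 1 /\ rlc N D x = 2%:R * a1
  | zminus => rord N D x = 1 /\ rlc N D x = - (2%:R * a1)
  | pplus  => rord N D x = -1 /\ rlc N D x = 1
  | pminus => rord N D x = -1 /\ rlc N D x = -1
  end.

(* The singularity signature of N/D is  pre ++ [hat s0] ++ post :
   the real zeros and poles t_1 < ... < t_N of N/D have the listed types,
   and the hatted letter s0 is the one located at t = 0. *)
Definition signature_is (a1 : R) (N D : {poly R})
    (pre : seq sing) (s0 : sing) (post : seq sing) : Prop :=
  let w := pre ++ s0 :: post in
  exists ts : seq R,
    [/\ sorted <%R ts,
        (forall x : R, (x \in ts) = (rord N D x != 0)),
        size ts = size w,
        (forall i, (i < size w)%N -> has_type a1 N D (nth 0 ts i) (nth s0 w i))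
      & nth 0 ts (size pre) = 0].

End Okamoto.

Definition wpow (w : seq sing) (k : nat) : seq sing := flatten (nseq k w).

(* the P_IV parameter a_1 = 1/3 + n of q_{m,n} *)
Definition okA1 (R : rcfType) (n : int) : R := 1 / 3%:R + n%:~R.

Definition sig_okamoto (R : rcfType) (m n : int)
    (pre : seq sing) (s0 : sing) (post : seq sing) : Prop :=
  signature_is (okA1 R n) (qnum R m n) (qden R m n) pre s0 post.

(* Main.v *)
Require Import Defs.
From HB Require Import structures.
From mathcomp Require Import all_boot all_order all_algebra.
From mathcomp Require Import ring lra zify polyrcf.
Set Implicit Arguments. Unset Strict Implicit. Unset Printing Implicit Defensive.
Import Order.TTheory GRing.Theory Num.Theory.
Local Open Scope ring_scope.

(** The Q_{m,n} are tau functions on a triangular lattice. Three mutually adjacent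
    ones satisfy Hirota bilinear equations, and reflecting a vertex C across the
    opposite edge A -> B replaces it by D with C D = edge(A,B) / sqrt 2; the Hirota
    equations are equivalent to C edge(A,B)' - 2 edge(A,B) C' = 2 P_C A B C, which
    gives the divisibility, and propagate to the new triangle. Two successive
    reflections yield the Toda recurrences that define the Q_{m,n}.
    The rational q_{m,n} is a constant multiple of edge(A,B) / (A B) = sqrt 2 C D / (A B)
    with A = Q_{m-1,n}, B = Q_{m,n}, C = Q_{m-1,n+1}, D = Q_{m,n-1}, so its poles are
    the zeros of A and B and its zeros are those of C and D.
    For P_C > 0 the derivative of H = A B C D at a real zero is negative at zeros of
    A and C, positive at zeros of B and D, and alternates along the line, starting and
    ending with plus. Hence the order of the zeros of A, B, C determines where the
    zeros of D lie, and the signature is computed by induction along the lattice;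
    the centre letter sits at 0 because every Q_{m,n} is even or odd. *)

(** * Reflections and Toda equations *)

Section Reflection.
Variable R : rcfType.
Implicit Types A B C D O : {poly R}.

(** [edge A B] is 3 A B (2 X / 3 + (log (B / A))'); for A = Q_{m-1,n} and B = Q_{m,n} this is -3 A B
    q_{m,n}. *)
Definition edge A B : {poly R} := 2%:R * 'X * A * B + 3%:R * (A * B^`() - A^`() * B).

Definition rt2 : {poly R} := (Num.sqrt (2%:R : R) / 2%:R)%:P.

Lemma rt2_sq : 2%:R * rt2 ^+ 2 = 1.
Proof.
rewrite /rt2 -polyC_exp -polyC_natr -polyCM expr_div_n sqr_sqrtr ?ler0n //.
by congr _%:P; field.
Qed.

(** Nine times Hirota's bilinear D^2 A.B with a first-order and a constant term. Swapping A and B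
    flips the first-order term, whence the orientation of triangles. *)
Definition hirota A B (P Q : int) : {poly R} :=
  9%:R * (A^`()^`() * B - 2%:R * A^`() * B^`() + A * B^`()^`())
  + 6%:R * 'X * (A^`() * B - A * B^`()) + 2%:R * (P - Q)%:~R * A * B.

Definition regular_poly A : Prop :=
  [/\ coprimep A A^`(), 0 < lead_coef A
    & exists b : bool, A \Po - 'X = (-1) ^+ b * A].

(* A -> B -> C -> A is oriented; PA, PB, PC are three times the P_IV parameters
   attached to the vertices (each to the zeros of the f on the opposite edge). *)
Record tau_triple A B C (PA PB PC : int) : Prop := TauTriple {
  tt_sum : PA + PB + PC = 3;
  tt_AB : hirota A B PA PB = 0;
  tt_BC : hirota B C PB PC = 0;
  tt_CA : hirota C A PC PA = 0;
  tt_A : regular_poly A;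
  tt_B : regular_poly B;
  tt_C : regular_poly C }.

Lemma tau_rot A B C PA PB PC :
  tau_triple A B C PA PB PC -> tau_triple B C A PB PC PA.
Proof. by case=> s *; split=> //; rewrite -s addrC addrA. Qed.

Lemma tau_cast A B C PA PB PC QA QB QC : tau_triple A B C PA PB PC ->
  PA = QA -> PB = QB -> PC = QC -> tau_triple A B C QA QB QC.
Proof. by move=> t <- <- <-. Qed.

Lemma deriv_edge A B :
  (edge A B)^`() = 2%:R * A * B + 2%:R * 'X * (A^`() * B + A * B^`())
                   + 3%:R * (A * B^`()^`() - A^`()^`() * B).
Proof.
by rewrite /edge !derivE; ring.
Qed.

Lemma lc_gt0_neq0 A : 0 < lead_coef A -> A != 0.
Proof. by move=> /lt0r_neq0; rewrite lead_coef_eq0. Qed.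

Lemma natp_inj n (p q : {poly R}) : n.+1%:R * p = n.+1%:R * q -> p = q.
Proof. by apply: mulfI; rewrite -polyC_natr polyC_eq0 pnatr_eq0. Qed.

(** Once the sum rule has eliminated PA, three times the difference of the sides is A times the
    equation for (B, C) minus B times the one for (C, A). *)
Lemma edge_key A B C PA PB PC : tau_triple A B C PA PB PC ->
  C * (edge A B)^`() - 2%:R * edge A B * C^`() = 2%:R * PC%:~R * A * B * C.
Proof.
case=> s _ hBC hCA _ _ _.
have {}s : PA = 3 - PB - PC by rewrite -s; ring.
apply: (@natp_inj 2); apply/eqP; rewrite -subr_eq0; apply/eqP.
transitivity (A * hirota B C PB PC - B * hirota C A PC PA).
  by rewrite s deriv_edge /edge /hirota; ring.
by rewrite hBC hCA; ring.
Qed.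

(** Substituting C D for the edge in [edge_key] leaves a common factor C to cancel. *)
Lemma reflect_wronskian A B C D PA PB PC : tau_triple A B C PA PB PC ->
  C * D = rt2 * edge A B ->
  C * D^`() - C^`() * D = 2%:R * rt2 * PC%:~R * A * B.
Proof.
move=> t e; have k := edge_key t.
have nzC : C != 0 by case: t => _ _ _ _ _ _ [_ /lc_gt0_neq0].
apply: (mulfI nzC).
have e' : C^`() * D + C * D^`() = rt2 * (edge A B)^`().
  by rewrite -derivM e derivM /rt2 derivC mul0r add0r.
transitivity (C * (rt2 * (edge A B)^`()) - 2%:R * C^`() * (rt2 * edge A B)).
  by rewrite -e' -e; ring.
transitivity (rt2 * (C * (edge A B)^`() - 2%:R * edge A B * C^`())); first by ring.
by rewrite k; ring.
Qed.

(** C times a new equation is D times an old one plus terms in the Wronskian of C, D and its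
    derivative, both known from [reflect_wronskian]. *)
Lemma reflect_hirota A B C D PA PB PC : tau_triple A B C PA PB PC ->
  C * D = rt2 * edge A B ->
  hirota B D (PB + PC) (- PC) = 0 /\ hirota D A (- PC) (PA + PC) = 0.
Proof.
move=> t e; have w := reflect_wronskian t e.
have nzC : C != 0 by case: t => _ _ _ _ _ _ [_ /lc_gt0_neq0].
have w' : C * D^`()^`() - C^`()^`() * D
          = 2%:R * rt2 * PC%:~R * (A^`() * B + A * B^`()).
  have dc : (2%:R * rt2 * PC%:~R)^`() = 0.
    by rewrite /rt2 -polyC_natr -(rmorph_int (@polyC R)) -!polyCM derivC.
  have := congr1 (fun p => p^`()) w.
  rewrite -mulrA derivM dc mul0r add0r derivB !derivM => E.
  transitivity (C^`() * D^`() + C * D^`()^`() - (C^`()^`() * D + C^`() * D^`())).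
    by ring.
  by rewrite E; ring.
case: t => s hAB hBC hCA _ _ _.
have {}s : PA = 3 - PB - PC by rewrite -s; ring.
split; apply: (mulfI nzC); rewrite mulr0.
  transitivity (D * hirota B C PB PC
    + 9%:R * (B * (C * D^`()^`() - C^`()^`() * D) - 2%:R * B^`() * (C * D^`() - C^`() * D))
    - 6%:R * 'X * B * (C * D^`() - C^`() * D) + 6%:R * PC%:~R * B * (C * D)).
    by rewrite /hirota; ring.
  by rewrite hBC w w' e /edge; ring.
transitivity (D * hirota C A PC PA
  + 9%:R * (A * (C * D^`()^`() - C^`()^`() * D) - 2%:R * A^`() * (C * D^`() - C^`() * D))
  + 6%:R * 'X * A * (C * D^`() - C^`() * D) - 6%:R * PC%:~R * A * (C * D)).
  by rewrite /hirota; ring.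
by rewrite hCA w w' e /edge; ring.
Qed.

Lemma todaRHS4 (c : int) O : 4%:R * todaRHS c%:~R O =
  18%:R * (O^`()^`() * O - O^`() ^+ 2)
  + 4%:R * (2%:R * 'X ^+ 2 + c%:~R) * O ^+ 2.
Proof.
rewrite /todaRHS -!mul_polyC (rmorph_int (@polyC R)).
have e : 4%:R * (9%:R / 2%:R)%:P = 18%:R :> {poly R}.
  by rewrite -!polyC_natr -polyCM; congr _%:P; field.
by rewrite mulrDr mulrA e !polyC_natr; ring.
Qed.

(** Reflecting a and then b about the fixed vertex O puts a and b' opposite each other. The
    Wronskian of a, a' and then the first edge eliminate a'; what is left is a combination of the
    three Hirota equations. *)
Lemma toda_forward O a b a' b' PO Pa Pb : tau_triple O a b PO Pa Pb ->
  a * a' = rt2 * edge b O -> b * b' = rt2 * edge O a' ->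
  a * b' = todaRHS ((2 * Pa + Pb)%:~R) O.
Proof.
move=> t ea eb; have w := reflect_wronskian (tau_rot (tau_rot t)) ea.
case: (t) => s hOa hab hbO _ [_ /lc_gt0_neq0 nza _] [_ /lc_gt0_neq0 nzb _].
have {}s : PO = 3 - Pa - Pb by rewrite -s; ring.
apply: (@natp_inj 3); apply: (mulfI (mulf_neq0 nza nzb)).
transitivity (4%:R * a * (a * (b * b'))); first by ring.
rewrite eb.
transitivity (4%:R * rt2 * a * (2%:R * 'X * O * (a * a')
   + 3%:R * (O * (a * a'^`() - a^`() * a') + (O * a^`() - O^`() * a) * a'))).
  by rewrite /edge; ring.
rewrite w.
transitivity (4%:R * rt2 * (2%:R * 'X * O * a * (a * a')
   + 3%:R * (a * O * (2%:R * rt2 * Pa%:~R * b * O) + (O * a^`() - O^`() * a) * (a * a')))).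
  by ring.
rewrite ea.
transitivity (2%:R * (2%:R * rt2 ^+ 2) * (edge b O * (2%:R * 'X * O * a
   + 3%:R * (O * a^`() - O^`() * a)) + 6%:R * Pa%:~R * a * b * O ^+ 2)).
  by ring.
rewrite rt2_sq.
transitivity (a * b * (4%:R * todaRHS (2 * Pa + Pb)%:~R O)); last by ring.
rewrite todaRHS4; apply/esym/eqP; rewrite -subr_eq0; apply/eqP.
transitivity (b * O * hirota O a PO Pa + a * O * hirota b O Pb PO
              - O ^+ 2 * hirota a b Pa Pb).
  by rewrite s /hirota /edge; ring.
by rewrite hOa hbO hab; ring.
Qed.

(** The mirror image of [toda_forward]: b is reflected first and b, a' become opposite. *)
Lemma toda_backward O a b a' b' PO Pa Pb : tau_triple O a b PO Pa Pb ->
  b * b' = rt2 * edge O a -> a * a' = rt2 * edge b' O ->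
  b * a' = todaRHS ((- (2 * Pb + Pa))%:~R) O.
Proof.
move=> t eb ea; have w := reflect_wronskian t eb.
case: (t) => s hOa hab hbO _ [_ /lc_gt0_neq0 nza _] [_ /lc_gt0_neq0 nzb _].
have {}s : PO = 3 - Pa - Pb by rewrite -s; ring.
apply: (@natp_inj 3); apply: (mulfI (mulf_neq0 nza nzb)).
transitivity (4%:R * b * (b * (a * a'))); first by ring.
rewrite ea.
transitivity (4%:R * rt2 * b * (2%:R * 'X * O * (b * b')
   + 3%:R * ((O^`() * b - O * b^`()) * b' - O * (b * b'^`() - b^`() * b')))).
  by rewrite /edge; ring.
rewrite w.
transitivity (4%:R * rt2 * (2%:R * 'X * O * b * (b * b')
   - 3%:R * (b * O * (2%:R * rt2 * Pb%:~R * O * a) + (O * b^`() - O^`() * b) * (b * b')))).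
  by ring.
rewrite eb.
transitivity (2%:R * (2%:R * rt2 ^+ 2) * (edge O a * (2%:R * 'X * O * b
   - 3%:R * (O * b^`() - O^`() * b)) - 6%:R * Pb%:~R * a * b * O ^+ 2)).
  by ring.
rewrite rt2_sq.
transitivity (a * b * (4%:R * todaRHS (- (2 * Pb + Pa))%:~R O)); last by ring.
rewrite todaRHS4; apply/esym/eqP; rewrite -subr_eq0; apply/eqP.
transitivity (b * O * hirota O a PO Pa + a * O * hirota b O Pb PO
              - O ^+ 2 * hirota a b Pa Pb).
  by rewrite s /hirota /edge; ring.
by rewrite hOa hbO hab; ring.
Qed.

End Reflection.
Arguments rt2 {R}.

(** * Squarefreeness, degree and parity under reflection *)

Section Regularity.
Variable R : rcfType.
Implicit Types A B C D O : {poly R}.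

Lemma rt2_unit : exists2 c : R, 0 < c & rt2 = c%:P.
Proof.
exists (Num.sqrt (2%:R : R) / 2%:R); last by [].
by rewrite divr_gt0 ?sqrtr_gt0 ?ltr0n.
Qed.

Lemma dvdp_natmul d n (p : {poly R}) : (d %| n.+1%:R * p) = (d %| p).
Proof. by rewrite -polyC_natr mul_polyC dvdpZr ?pnatr_eq0. Qed.

(** Modulo a common divisor of A and B the equation leaves only 18 A' B', while squarefreeness makes
    such a divisor coprime to A' and B'. *)
Lemma hirota_coprime A B P Q : hirota A B P Q = 0 ->
  coprimep A A^`() -> coprimep B B^`() -> coprimep A B.
Proof.
move=> h cA cB; apply/coprimepP => d dA dB.
have cd : coprimep d (A^`() * B^`()).
  by rewrite coprimepMr (coprimep_dvdr dA) ?(coprimep_dvdr dB) // coprimep_sym.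
have : d %| 18%:R * (A^`() * B^`()).
  have -> : 18%:R * (A^`() * B^`()) = 18%:R * (A^`() * B^`()) + hirota A B P Q.
    by rewrite h addr0.
  have -> : 18%:R * (A^`() * B^`()) + hirota A B P Q =
    A * (9%:R * B^`()^`() - 6%:R * 'X * B^`() + 2%:R * (P - Q)%:~R * B)
    + B * (9%:R * A^`()^`() + 6%:R * 'X * A^`()) by rewrite /hirota; ring.
  by rewrite dvdp_add // dvdp_mulr.
rewrite dvdp_natmul => dAB.
by move/coprimepP: cd => /(_ d (dvdpp d) dAB).
Qed.

Lemma edge_coprime A B P Q : hirota A B P Q = 0 ->
  coprimep A A^`() -> coprimep B B^`() -> coprimep (A * B) (edge A B).
Proof.
move=> h cA cB; have cAB := hirota_coprime h cA cB.
rewrite coprimepMl; apply/andP; split; apply/coprimepP => d dA dE.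
  have : d %| 3%:R * (A^`() * B).
    have -> : 3%:R * (A^`() * B) = A * (2%:R * 'X * B + 3%:R * B^`()) - edge A B.
      by rewrite /edge; ring.
    by rewrite dvdp_sub // dvdp_mulr.
  rewrite dvdp_natmul => dAB.
  have : coprimep d (A^`() * B).
    by rewrite coprimepMr !(coprimep_dvdr dA) // coprimep_sym.
  by move/coprimepP => /(_ d (dvdpp d) dAB).
have : d %| 3%:R * (A * B^`()).
  have -> : 3%:R * (A * B^`()) = edge A B - B * (2%:R * 'X * A - 3%:R * A^`()).
    by rewrite /edge; ring.
  by rewrite dvdp_sub // dvdp_mulr.
rewrite dvdp_natmul => dAB.
have : coprimep d (A * B^`()).
  by rewrite coprimepMr !(coprimep_dvdr dA) // coprimep_sym // coprimep_sym.
by move/coprimepP => /(_ d (dvdpp d) dAB).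
Qed.

Lemma edge_lead A B : A != 0 -> B != 0 ->
  lead_coef (edge A B) = 2%:R * (lead_coef A * lead_coef B) /\
  size (edge A B) = (size A + size B)%N.
Proof.
move=> nzA nzB.
have nzAB : A * B != 0 by rewrite mulf_neq0.
have szXAB : size (2%:R * 'X * A * B) = (size A + size B)%N.
  rewrite -polyC_natr -!mulrA mul_polyC size_scale ?pnatr_eq0 //.
  rewrite mulrC size_mulX // size_mul // prednK // addn_gt0.
  by rewrite size_poly_gt0 nzA.
have szW : (size (3%:R * (A * B^`() - A^`() * B))%R < size (2%:R * 'X * A * B)%R)%N.
  rewrite szXAB -polyC_natr mul_polyC size_scale ?pnatr_eq0 //.
  apply: leq_ltn_trans (size_polyD _ _) _; rewrite size_polyN gtn_max.
  have pA : (0 < size A)%N by rewrite size_poly_gt0.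
  have pB : (0 < size B)%N by rewrite size_poly_gt0.
  have lA := lt_size_deriv nzA; have lB := lt_size_deriv nzB.
  have auxr a b b' : (0 < a -> b' < b -> (a + b').-1 < a + b)%N by lia.
  have auxl a a' b : (0 < b -> a' < a -> (a' + b).-1 < a + b)%N by lia.
  apply/andP; split; apply: leq_ltn_trans (size_polyMleq _ _) _.
    exact: auxr.
  exact: auxl.
split; last by rewrite size_polyDl.
rewrite lead_coefDl // -polyC_natr !lead_coefM lead_coefX lead_coefC.
by rewrite mulr1 -mulrA.
Qed.

Lemma deriv_parity A (b : bool) : A \Po - 'X = (-1) ^+ b * A ->
  A^`() \Po - 'X = - ((-1) ^+ b * A^`()).
Proof.
move=> /(congr1 (fun p => p^`())); rewrite deriv_comp derivN derivX.
case: b; rewrite ?expr0 ?expr1 ?mul1r ?mulN1r ?derivN ?mulrN1 => E.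
  by apply: oppr_inj; rewrite E opprK.
by apply: oppr_inj; rewrite E opprK.
Qed.

(** By [edge_key], C divides 2 [edge A B] C', and C is coprime to C'. *)
Lemma reflect_exists A B C PA PB PC : tau_triple A B C PA PB PC ->
  exists D, C * D = rt2 * edge A B.
Proof.
move=> t; have k := edge_key t; case: t => _ _ _ _ _ _ [cC lC _].
have : C %| edge A B.
  rewrite -(Gauss_dvdpl _ cC) -(@dvdp_natmul _ 1) mulrA.
  have -> : 2%:R * edge A B * C^`()
          = C * ((edge A B)^`() - 2%:R * PC%:~R * A * B).
    by apply/eqP; rewrite -subr_eq0 -oppr_eq0; apply/eqP;
       transitivity (C * (edge A B)^`() - 2%:R * edge A B * C^`()
         - 2%:R * PC%:~R * A * B * C); [ring | rewrite k subrr].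
  by rewrite dvdp_mulr.
case/dvdpP => q ->; exists (rt2 * q); ring.
Qed.

(** The term 2 X A B dominates the edge. The size relation later makes the degree of A B C D odd. *)
Lemma reflect_size A B C D PA PB PC : tau_triple A B C PA PB PC ->
  C * D = rt2 * edge A B ->
  0 < lead_coef D /\ (size C + size D = (size A + size B).+1)%N.
Proof.
case=> _ _ _ _ [_ lA _] [_ lB _] [_ lC _] e.
have [le se] := edge_lead (lc_gt0_neq0 lA) (lc_gt0_neq0 lB).
have [c c0 rE] := rt2_unit; rewrite rE in e.
have lD : 0 < lead_coef C * lead_coef D.
  by rewrite -lead_coefM e lead_coefM lead_coefC le !mulr_gt0 ?ltr0n.
rewrite pmulr_rgt0 // in lD; split=> //.
have := congr1 (fun p => size (p : {poly R})) e.
rewrite mul_polyC size_scale ?lt0r_neq0 // se.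
rewrite size_mul ?lc_gt0_neq0 // => <-; rewrite prednK //.
by rewrite addn_gt0 size_poly_gt0 lc_gt0_neq0.
Qed.

(** D divides a constant multiple of the edge, which is coprime to A B. A common divisor of D and D'
    divides the Wronskian, a nonzero multiple of A B since PC is nonzero. *)
Lemma reflect_coprime A B C D PA PB PC : tau_triple A B C PA PB PC ->
  PC != 0 -> C * D = rt2 * edge A B -> coprimep (A * B) D /\ coprimep D D^`().
Proof.
move=> t pC e; have w := reflect_wronskian t e.
case: t => _ hAB _ _ [cA _ _] [cB _ _] _.
have [c c0 rE] := rt2_unit.
have cAB : coprimep (A * B) D.
  have : coprimep (A * B) (C * D).
    rewrite e rE mul_polyC coprimepZr ?lt0r_neq0 //; exact: edge_coprime hAB cA cB.
  by rewrite coprimepMr => /andP[].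
split=> //; apply/coprimepP => d dD dD'.
have : d %| 2%:R * rt2 * PC%:~R * A * B.
  by rewrite -w dvdp_sub // dvdp_mull.
rewrite -!mulrA dvdp_natmul rE mul_polyC dvdpZr ?lt0r_neq0 //.
rewrite -(rmorph_int (@polyC R)) mul_polyC dvdpZr ?intr_eq0 // => dAB.
have : coprimep d (A * B) by rewrite (coprimep_dvdr dD) // coprimep_sym.
by move/coprimepP => /(_ d (dvdpp d) dAB).
Qed.

Lemma reflect_parity A B C D PA PB PC : tau_triple A B C PA PB PC ->
  C * D = rt2 * edge A B -> exists b : bool, D \Po - 'X = (-1) ^+ b * D.
Proof.
case=> _ _ _ _ [_ _ [a eA]] [_ _ [b eB]] [_ lC [c eC]] e.
(* Multiplying by X or differentiating changes parity, so the edge has parity opposite to A B. *)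
exists (~~ (a (+) b (+) c)).
have := congr1 (fun p => p \Po - 'X) e.
have nC : (-1) ^+ c * C != 0 by rewrite mulf_neq0 ?signr_eq0 ?lc_gt0_neq0.
rewrite /edge !(rmorphM, rmorphD, rmorphN, rmorph1) /= comp_polyX.
have -> : rt2 \Po - 'X = rt2 :> {poly R} by rewrite /rt2 comp_polyC.
rewrite (deriv_parity eA) (deriv_parity eB) eA eB eC => E.
apply: (mulfI nC); rewrite E.
transitivity (- (-1) ^+ a * (-1) ^+ b * (rt2 * edge A B)); first by rewrite /edge; ring.
rewrite -e; case: (a) (b) (c) => [] [] []; rewrite /= ?expr0 ?expr1; ring.
Qed.

(** On the parameters this is a simple reflection of the affine Weyl group of type A_2. The equation
    for (A, B) survives because it sees only PA - PB. *)
Lemma reflect_triple A B C D PA PB PC : tau_triple A B C PA PB PC ->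
  PC != 0 -> C * D = rt2 * edge A B ->
  tau_triple A B D (PA + PC) (PB + PC) (- PC).
Proof.
move=> t pC e; have [hBD hDA] := reflect_hirota t e.
have [lD _] := reflect_size t e; have [_ cD] := reflect_coprime t pC e.
have pD := reflect_parity t e.
case: t => s hAB _ _ rA rB _; split=> //; first by rewrite -s; ring.
by rewrite -hAB /hirota; ring.
Qed.

End Regularity.

(** * Real roots *)

Section RealRoots.
Variable R : rcfType.
Implicit Types (A B C D H : {poly R}) (x y : R) (s : seq R).

Lemma mem_rootsR H x : H != 0 -> (x \in rootsR H) = root H x.
Proof. by move=> /roots_on_rootsR <-; rewrite in_itv. Qed.

Lemma sorted_rootsR H : sorted <%R (rootsR H).
Proof. exact: sorted_roots. Qed.

Lemma rootsR_filter A B : A * B != 0 ->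
  rootsR A = [seq x <- rootsR (A * B) | root A x].
Proof.
move=> nz; have nzA : A != 0 by apply: contraNneq nz => ->; rewrite mul0r.
apply: (irr_sorted_eq lt_trans ltxx (sorted_rootsR A)).
  by apply: sorted_filter; [exact: lt_trans | exact: sorted_rootsR].
by move=> x; rewrite mem_filter !mem_rootsR // rootM; case: root.
Qed.

Lemma deriv_factor (K : {poly R}) x : (('X - x%:P) * K)^`().[x] = K.[x].
Proof.
by rewrite derivM derivXsubC hornerD !hornerM hornerXsubC subrr mul0r addr0
  hornerC mul1r.
Qed.

Lemma factor_root H x : root H x -> exists K, H = ('X - x%:P) * K.
Proof. by case/factor_theorem => K ->; exists K; rewrite mulrC. Qed.

Lemma deriv_last_root H x : 0 < lead_coef H -> root H x -> H^`().[x] != 0 ->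
  (forall y, x < y -> ~~ root H y) -> 0 < H^`().[x].
Proof.
move=> lH /factor_root[K eH]; rewrite eH deriv_factor => nK nr.
have lK : 0 < lead_coef K by rewrite eH lead_coefM lead_coefXsubC mul1r in lH.
have rK : {in `[x, +oo[, forall y, ~~ root K y}.
  move=> y; rewrite in_itv /= andbT le_eqVlt => /predU1P[<- //|xy].
  by have := nr y xy; rewrite rootM negb_or => /andP[].
rewrite -sgr_gt0 (sgp_pinftyP rK) ?in_itv /= ?lexx //.
by rewrite /sgp_pinfty sgr_gt0.
Qed.

(** Dividing out X - x leaves a cofactor of even degree, positive at minus infinity and without
    roots up to x, whose value at x is the derivative. *)
Lemma deriv_first_root H x : 0 < lead_coef H -> ~~ odd (size H) ->
  root H x -> H^`().[x] != 0 ->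
  (forall y, y < x -> ~~ root H y) -> 0 < H^`().[x].
Proof.
move=> lH oH /factor_root[K eH]; rewrite eH deriv_factor => nK nr.
have lK : 0 < lead_coef K by rewrite eH lead_coefM lead_coefXsubC mul1r in lH.
have nzK := lc_gt0_neq0 lK.
have rK : {in `]-oo, x], forall y, ~~ root K y}.
  move=> y; rewrite in_itv /= le_eqVlt => /predU1P[-> //|xy].
  by have := nr y xy; rewrite rootM negb_or => /andP[].
have sK : ~~ odd (size K).-1.
  move: oH; rewrite eH size_monicM ?monicXsubC // size_XsubC /=.
  have := nzK; rewrite -size_poly_gt0; case: (size K) => //= n _.
  by rewrite negbK => /negbTE ->.
rewrite -sgr_gt0 (sgp_minftyP rK) ?in_itv /= ?lexx //.
by rewrite /sgp_minfty -signr_odd (negbTE sK) mul1r sgr_gt0.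
Qed.

(** With H = (X - x) (X - y) M, M keeps its sign on [x, y], and the factors x - y and y - x give
    opposite signs. *)
Lemma deriv_next_root H x y : x < y -> root H x -> root H y ->
  H^`().[x] != 0 -> H^`().[y] != 0 ->
  (forall z, x < z < y -> ~~ root H z) -> H^`().[x] * H^`().[y] < 0.
Proof.
move=> xy rx ry nx ny nr.
have [K eK] := factor_root rx.
have : root K y.
  by move: ry; rewrite eK rootM root_XsubC gt_eqF.
case/factor_root => M eM; subst K.
have hx : H^`().[x] = (x - y) * M.[x].
  by rewrite eK deriv_factor hornerM hornerXsubC.
have hy : H^`().[y] = (y - x) * M.[y].
  by rewrite eK mulrCA deriv_factor hornerM hornerXsubC.
have nM z : x < z < y -> ~~ root M z.
  by move=> /nr; rewrite eK !rootM !negb_or => /and3P[].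
have pM : 0 < M.[x] * M.[y].
  rewrite lt_neqAle eq_sym; apply/andP; split.
    rewrite mulf_neq0 //.
      by apply: contraNneq nx => e; rewrite hx e mulr0.
    by apply: contraNneq ny => e; rewrite hy e mulr0.
  rewrite leNgt; apply/negP => /(poly_ivtoo (ltW xy))[z].
  by rewrite in_itv => /nM /negbTE ->.
have -> : H^`().[x] * H^`().[y] = - ((y - x) ^+ 2 * (M.[x] * M.[y])).
  by rewrite hx hy; ring.
by rewrite oppr_lt0 mulr_gt0 // exprn_gt0 // subr_gt0.
Qed.

(** The empty word is accepted only when a minus is due, so [alternates true] forces the word to end
    as well as to begin with plus. *)
Fixpoint alternates (b : bool) (v : seq bool) : bool :=
  if v is c :: v' then (c == b) && alternates (~~ b) v' else ~~ b.

Lemma rootsR_alternates H : 0 < lead_coef H -> ~~ odd (size H) ->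
  (forall x, root H x -> H^`().[x] != 0) ->
  alternates true [seq 0 < H^`().[x] | x <- rootsR H].
Proof.
move=> lH oH sH; have nzH := lc_gt0_neq0 lH.
have step s x : root H x -> path <%R x s ->
    (forall y, x < y -> root H y = (y \in s)) ->
    alternates (0 < H^`().[x]) [seq 0 < H^`().[y] | y <- x :: s].
  elim: s x => [|y s IH] x rx /= => [_ nr|/andP[xy ps] nr].
    by rewrite deriv_last_root ?sH // => z /nr ->.
  have ry : root H y by rewrite nr ?mem_head.
  have sy := order_path_min lt_trans ps.
  rewrite eqxx /=.
  have <- : (0 < H^`().[y]) = ~~ (0 < H^`().[x]).
    have : H^`().[x] * H^`().[y] < 0.
      apply: deriv_next_root; rewrite ?sH // => z /andP[xz zy].
      rewrite nr // inE lt_eqF //=; apply/negP => /(allP sy).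
      by rewrite ltNge ltW.
    case: (ltrgtP 0 H^`().[x]) => hx.
    - by rewrite pmulr_rlt0 // => /ltW; rewrite leNgt => /negbTE.
    - by rewrite nmulr_rlt0 // => ->.
    - by rewrite -hx mul0r ltxx.
  apply: (IH y ry ps) => z yz; rewrite nr ?(lt_trans xy) // inE gt_eqF //.
(* Odd degree supplies a root: the empty list would fail [alternates true]. *)
have [z rz] := odd_poly_root oH.
have hroot y : root H y = (y \in rootsR H) by rewrite mem_rootsR.
have := sorted_rootsR H; rewrite hroot in rz.
case: (rootsR H) rz hroot => // x s _ hroot ps.
have rx : root H x by rewrite hroot mem_head.
have sx := order_path_min lt_trans ps.
have <- : 0 < H^`().[x] = true.
  apply: deriv_first_root; rewrite ?sH // => y yx.
  rewrite hroot inE lt_eqF //=; apply/negP => /(allP sx).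
  by rewrite ltNge ltW.
by apply: step => // y xy; rewrite hroot inE gt_eqF.
Qed.

End RealRoots.

(** * Words with alternating signs *)

Definition sing_code (s : sing) : nat :=
  match s with zplus => 0 | zminus => 1 | pplus => 2 | pminus => 3 end.

Definition sing_decode (n : nat) : sing :=
  match n with 0 => zplus | 1 => zminus | 2 => pplus | _ => pminus end.

Lemma sing_codeK : cancel sing_code sing_decode. Proof. by case. Qed.

HB.instance Definition _ := Equality.copy sing (can_type sing_codeK).

(* Recovers a word whose signs alternate (plus at g and h only, last sign plus) from
   the word without its letters g; b tells whether the next sign due is plus. *)
Fixpoint interlace (g h : sing) (b : bool) (v : seq sing) : seq sing :=
  if v is x :: v' then
    (if b && (x != h) then [:: g; x] else [:: x]) ++ interlace g h (x != h) v'
  else if b then [:: g] else [::].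

(** No two plus letters are adjacent, so a deleted [g] betrays itself: a plus is due, but the next
    remaining letter is not [h], or the word has ended. *)
Lemma interlaceP g h b (w : seq sing) :
  alternates b [seq (x == g) || (x == h) | x <- w] -> g != h ->
  w = interlace g h b [seq x <- w | x != g].
Proof.
move=> aw gh; elim: w b aw => [|y w IH] b /=; first by case: b.
case/andP=> /eqP<- {b}; have [->|yg] /= := eqVneq y g => aw.
  rewrite [in LHS](IH _ aw).
  case: w aw {IH} => //= z w.
  have [//|/= zg] := eqVneq z g.
  by have [//|] := eqVneq z h.
move: aw; have [->|yh] /= := eqVneq y h => aw; first by rewrite -(IH _ aw).
by rewrite -(IH _ aw).
Qed.

(** * Labelled real roots around one reflection *)

Section Words.
Variable R : rcfType.
Implicit Types (A B C D : {poly R}) (x : R) (l : R -> sing).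

Lemma tau_root A B C PA PB PC x : tau_triple A B C PA PB PC -> A.[x] = 0 ->
  [/\ A^`().[x] != 0, B.[x] != 0 & C.[x] != 0].
Proof.
case=> _ hAB _ hCA [cA _ _] [cB _ _] [cC _ _] /eqP rA.
split; first exact: coprimep_root cA rA.
  exact: coprimep_root (hirota_coprime hAB cA cB) rA.
by apply: coprimep_root rA; rewrite coprimep_sym; apply: hirota_coprime hCA cC cA.
Qed.

Lemma tau_neq0 A B C PA PB PC : tau_triple A B C PA PB PC -> A != 0.
Proof. by case=> _ _ _ _ [_ /lc_gt0_neq0]. Qed.

Lemma edgeE A B x : (edge A B).[x] =
  2%:R * x * A.[x] * B.[x] + 3%:R * (A.[x] * B^`().[x] - A^`().[x] * B.[x]).
Proof. by rewrite /edge -!polyC_natr !hornerE; ring. Qed.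

(** Every pair except C, D lies in a common triangle, before or after the reflection; C and D are
    separated by their nonvanishing Wronskian. *)
Lemma reflect_root A B C D PA PB PC x : tau_triple A B C PA PB PC ->
  PC != 0 -> C * D = rt2 * edge A B ->
  [/\ A.[x] = 0 -> [/\ A^`().[x] != 0, B.[x] != 0, C.[x] != 0 & D.[x] != 0],
      B.[x] = 0 -> [/\ A.[x] != 0, B^`().[x] != 0, C.[x] != 0 & D.[x] != 0],
      C.[x] = 0 -> [/\ A.[x] != 0, B.[x] != 0, C^`().[x] != 0 & D.[x] != 0]
    & D.[x] = 0 -> [/\ A.[x] != 0, B.[x] != 0, C.[x] != 0 & D^`().[x] != 0]].
Proof.
move=> t nP e; have t' := reflect_triple t nP e.
have [r1 r1'] := (tau_rot t, tau_rot t').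
have [r2 r2'] := (tau_rot r1, tau_rot r1').
have w := congr1 (fun p => p.[x]) (reflect_wronskian t e).
have [c c0 rE] := rt2_unit R; rewrite rE in w.
have {}w : C.[x] * D^`().[x] - C^`().[x] * D.[x] =
           2%:R * c * PC%:~R * A.[x] * B.[x].
  by move: w; rewrite -(rmorph_int (@polyC R)) -polyC_natr !hornerE.
split=> r.
- by have [] := tau_root t r; have [] := tau_root t' r.
- by have [] := tau_root r1 r; have [] := tau_root r1' r.
- have [? ? ?] := tau_root r2 r; split=> //.
  have : 2%:R * c * PC%:~R * A.[x] * B.[x] != 0.
    by rewrite !mulf_neq0 ?pnatr_eq0 ?intr_eq0 // gt_eqF.
  by rewrite -w r; apply: contraNneq => ->; rewrite mul0r mulr0 subr0.
have [? ? ?] := tau_root r2' r; split=> //.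
have : 2%:R * c * PC%:~R * A.[x] * B.[x] != 0.
  by rewrite !mulf_neq0 ?pnatr_eq0 ?intr_eq0 // gt_eqF.
by rewrite -w r; apply: contraNneq => ->; rewrite mul0r mulr0 subr0.
Qed.

Lemma mul_sqr_gt0 (k y : R) : 0 < k -> y != 0 -> 0 < k * y ^+ 2.
Proof. by move=> k0 y0; rewrite pmulr_rgt0 // exprn_even_gt0. Qed.

Lemma deriv_prod4 A B C D x : (A * B * C * D)^`().[x] =
  A^`().[x] * B.[x] * C.[x] * D.[x] + A.[x] * B^`().[x] * C.[x] * D.[x]
  + A.[x] * B.[x] * C^`().[x] * D.[x] + A.[x] * B.[x] * C.[x] * D^`().[x].
Proof. by rewrite !derivE !hornerE; ring. Qed.

(** At a root one term of the product rule survives. The edge relation at roots of A and B, the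
    Wronskian at roots of C and D, turns it into a signed positive multiple of a square. *)
Lemma reflect_sign A B C D PA PB PC x : tau_triple A B C PA PB PC ->
  0 < PC -> C * D = rt2 * edge A B ->
  [/\ A.[x] = 0 -> (A * B * C * D)^`().[x] < 0,
      B.[x] = 0 -> 0 < (A * B * C * D)^`().[x],
      C.[x] = 0 -> (A * B * C * D)^`().[x] < 0
    & D.[x] = 0 -> 0 < (A * B * C * D)^`().[x]].
Proof.
move=> t pP e; have nP : PC != 0 by rewrite gt_eqF.
have [rA rB rC rD] := reflect_root x t nP e.
have w := congr1 (fun p => p.[x]) (reflect_wronskian t e).
have {}e := congr1 (fun p => p.[x]) e.
have [c c0 rE] := rt2_unit R; rewrite rE in w e.
have {}w : C.[x] * D^`().[x] - C^`().[x] * D.[x] =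
           2%:R * c * PC%:~R * A.[x] * B.[x].
  by move: w; rewrite -(rmorph_int (@polyC R)) -polyC_natr !hornerE.
have {}e : C.[x] * D.[x] = c * (edge A B).[x] by move: e; rewrite !hornerE.
rewrite edgeE in e; rewrite deriv_prod4.
have p0 : 0 < PC%:~R :> R by rewrite ltr0z.
split=> r.
- have [a b _ _] := rA r; rewrite r in e *.
  have -> : A^`().[x] * B.[x] * C.[x] * D.[x] + 0 * B^`().[x] * C.[x] * D.[x] +
    0 * B.[x] * C^`().[x] * D.[x] + 0 * B.[x] * C.[x] * D^`().[x]
    = - (3%:R * c * (A^`().[x] * B.[x]) ^+ 2).
    by transitivity (A^`().[x] * B.[x] * (C.[x] * D.[x])); [ring | rewrite e; ring].
  by rewrite oppr_lt0 mul_sqr_gt0 ?mulf_neq0 // !mulr_gt0 ?ltr0n.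
- have [a b _ _] := rB r; rewrite r in e *.
  have -> : A^`().[x] * 0 * C.[x] * D.[x] + A.[x] * B^`().[x] * C.[x] * D.[x] +
    A.[x] * 0 * C^`().[x] * D.[x] + A.[x] * 0 * C.[x] * D^`().[x]
    = 3%:R * c * (A.[x] * B^`().[x]) ^+ 2.
    by transitivity (A.[x] * B^`().[x] * (C.[x] * D.[x])); [ring | rewrite e; ring].
  by rewrite mul_sqr_gt0 ?mulf_neq0 // !mulr_gt0 ?ltr0n.
- have [a b _ _] := rC r; rewrite r in w *.
  have -> : A^`().[x] * B.[x] * 0 * D.[x] + A.[x] * B^`().[x] * 0 * D.[x] +
    A.[x] * B.[x] * C^`().[x] * D.[x] + A.[x] * B.[x] * 0 * D^`().[x]
    = - (2%:R * c * PC%:~R * (A.[x] * B.[x]) ^+ 2).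
    transitivity (- (A.[x] * B.[x] * (0 * D^`().[x] - C^`().[x] * D.[x]))).
      by ring.
    by rewrite w; ring.
  by rewrite oppr_lt0 mul_sqr_gt0 ?mulf_neq0 // !mulr_gt0 ?ltr0n.
have [a b _ _] := rD r; rewrite r in w *.
have -> : A^`().[x] * B.[x] * C.[x] * 0 + A.[x] * B^`().[x] * C.[x] * 0 +
  A.[x] * B.[x] * C^`().[x] * 0 + A.[x] * B.[x] * C.[x] * D^`().[x]
  = 2%:R * c * PC%:~R * (A.[x] * B.[x]) ^+ 2.
  transitivity (A.[x] * B.[x] * (C.[x] * D^`().[x] - C^`().[x] * 0)).
    by ring.
  by rewrite w; ring.
by rewrite mul_sqr_gt0 ?mulf_neq0 // !mulr_gt0 ?ltr0n.
Qed.

Definition word l H := [seq l x | x <- rootsR H].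

(** [h] and [g] label the roots of B and D, exactly those where the derivative of the product is
    positive, so the alternation of signs locates the roots of D. *)
Lemma reflect_word A B C D PA PB PC l g h : tau_triple A B C PA PB PC ->
  0 < PC -> C * D = rt2 * edge A B -> g != h ->
  (forall x, A.[x] = 0 -> (l x != g) && (l x != h)) ->
  (forall x, B.[x] = 0 -> l x = h) ->
  (forall x, C.[x] = 0 -> (l x != g) && (l x != h)) ->
  (forall x, D.[x] = 0 -> l x = g) ->
  word l (A * B * C * D) = interlace g h true (word l (A * B * C)) /\
  word l (A * B * C) = [seq s <- word l (A * B * C * D) | s != g].
Proof.
move=> t pP e gh lA lB lC lD; have nP : PC != 0 by rewrite gt_eqF.
have [ldD sz] := reflect_size t e.
have [_ _ _ _ [_ ldA _] [_ ldB _] [_ ldC _]] := t.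
have ldH : 0 < lead_coef (A * B * C * D) by rewrite !lead_coefM !mulr_gt0.
have nzH := lc_gt0_neq0 ldH.
have szH : ~~ odd (size (A * B * C * D)).
  have nzA := lc_gt0_neq0 ldA; have nzB := lc_gt0_neq0 ldB.
  have nzC := lc_gt0_neq0 ldC; have nzD := lc_gt0_neq0 ldD.
  rewrite !size_mul ?mulf_neq0 //.
  move: nzA nzB nzC nzD; rewrite -!size_poly_gt0; move: sz.
  by move: (size A) (size B) (size C) (size D) => a b c d *; lia.
have rts x : x \in rootsR (A * B * C * D) ->
  [\/ A.[x] = 0, B.[x] = 0, C.[x] = 0 | D.[x] = 0].
  rewrite mem_rootsR // !rootM -!orbA.
  by case/or4P => /eqP ?; [constructor 1|constructor 2|constructor 3|constructor 4].
have flt : word l (A * B * C) = [seq s <- word l (A * B * C * D) | s != g].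
  rewrite /word (rootsR_filter nzH) filter_map; congr map.
  apply: eq_in_filter => x xr /=; rewrite !rootM /root.
  have [_ _ _ rD] := reflect_root x t nP e.
  case: (rts x xr) => r.
  - by rewrite r eqxx; case/andP: (lA x r) => ->.
  - by rewrite r eqxx orbT (lB x r) /= eq_sym gh.
  - by rewrite r eqxx orbT; case/andP: (lC x r) => ->.
  - have [/negPf-> /negPf-> /negPf-> _] := rD r.
    by rewrite (lD x r) eqxx.
split=> //; rewrite flt; apply: interlaceP => //.
have sgn x (xr : x \in rootsR (A * B * C * D)) : (A * B * C * D)^`().[x] != 0 /\
    (0 < (A * B * C * D)^`().[x]) = (l x == g) || (l x == h).
  have [sA sB sC sD] := reflect_sign x t pP e.
  case: (rts x xr) => r.
  - have s := sA r; rewrite lt_eqF // ltNge ltW //=.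
    by case/andP: (lA x r) => /negPf-> /negPf->.
  - by have s := sB r; rewrite gt_eqF // s (lB x r) eqxx orbT.
  - have s := sC r; rewrite lt_eqF // ltNge ltW //=.
    by case/andP: (lC x r) => /negPf-> /negPf->.
  - by have s := sD r; rewrite gt_eqF // s (lD x r) eqxx.
have := rootsR_alternates ldH szH.
have -> : [seq 0 < (A * B * C * D)^`().[x] | x <- rootsR (A * B * C * D)]
  = [seq (s == g) || (s == h) | s <- word l (A * B * C * D)].
  by rewrite /word -map_comp; apply/eq_in_map => x /sgn[].
by apply=> x; rewrite -mem_rootsR // => /sgn[].
Qed.

End Words.

(** * The lattice of Okamoto polynomials *)

Section Lattice.
Variable R : rcfType.
Implicit Types (A B C D O : {poly R}).

(* [lattice i j] is Q_{i-1,-j}. *)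
Definition lattice (i j : nat) : {poly R} :=
  if i is i'.+1 then (mpair R j i').2 else (colpair R (-1) j).1.

Lemma mpair_fst j i : (mpair R j i).1 = lattice i j.
Proof. by case: i => [|i] //=; case: (mpair R j i). Qed.

Lemma colpair_snd c j : (colpair R c j).2 = (colpair R c j.+1).1.
Proof. by rewrite /=; case: (colpair R c j). Qed.

Lemma colpair_rec c j : (colpair R c j.+2).1 =
  todaRHS (3 * (c + 2 * (- (j.+1 : int)) + 1))%:~R (colpair R c j.+1).1
    %/ (colpair R c j).1.
Proof.
by rewrite -[LHS]colpair_snd -[in RHS]colpair_snd /=; case: (colpair R c j).
Qed.

Lemma lattice_row i j : lattice i.+2 j =
  todaRHS (3 * (- 2 * (i : int) - (- (j : int)) - 1))%:~R (lattice i.+1 j)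
    %/ lattice i j.
Proof. by rewrite -(mpair_fst j i) /=; case: (mpair R j i). Qed.

Lemma lattice_col0 j : lattice 0 j.+2 =
  todaRHS (3 * (- 1 + 2 * (- (j.+1 : int)) + 1))%:~R (lattice 0 j.+1)
    %/ lattice 0 j.
Proof. exact: colpair_rec. Qed.

Lemma lattice_col1 j : lattice 1 j.+2 =
  todaRHS (3 * (0 + 2 * (- (j.+1 : int)) + 1))%:~R (lattice 1 j.+1)
    %/ lattice 1 j.
Proof. exact: colpair_rec. Qed.

Lemma divp_of_mul A B C : A != 0 -> A * B = C -> B = C %/ A.
Proof. by move=> nzA <-; rewrite mulKp. Qed.

(* The triangle Q_{m-1,n}, Q_{m,n}, Q_{m,n-1} with m = i and n = - (i + k). *)
Definition cell (i k : nat) : Prop :=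
  tau_triple (lattice i (i + k)) (lattice i.+1 (i + k)) (lattice i.+1 (i + k).+1)
    (1 + 3 * i%:Z) (1 + 3 * k%:Z) (1 - 3 * (i + k)%:Z).

(** With j = i + k, these two reflections carry [cell i k] to [cell i k.+1]: first Q_{m,n} is
    replaced by Q_{m-1,n-1}, then Q_{m-1,n} by Q_{m,n-2}. *)
Definition down_first i j := lattice i.+1 j * lattice i j.+1 =
  rt2 * edge (lattice i.+1 j.+1) (lattice i j).

Definition down_second i j := lattice i j * lattice i.+1 j.+2 =
  rt2 * edge (lattice i j.+1) (lattice i.+1 j.+1).

Lemma lattice00 : lattice 0 0 = 1. Proof. by []. Qed.
Lemma lattice10 : lattice 1 0 = 1. Proof. by []. Qed.
Lemma lattice11 : lattice 1 1 = 1. Proof. by []. Qed.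
Lemma lattice01 : lattice 0 1 = Num.sqrt (2%:R : R) *: 'X. Proof. by []. Qed.

Lemma edge11 : edge 1 1 = 2%:R * 'X :> {poly R}.
Proof. by rewrite /edge !derivE; ring. Qed.

Lemma rt2_double : rt2 * 2%:R = (Num.sqrt (2%:R : R))%:P.
Proof. by rewrite /rt2 -polyC_natr -polyCM; congr _%:P; field. Qed.

Lemma regular_poly1 : regular_poly (1 : {poly R}).
Proof.
split; rewrite ?coprime1p ?lead_coef1 ?ltr01 //.
by exists false; rewrite expr0 mul1r rmorph1.
Qed.

Lemma cell00 : cell 0 0.
Proof.
have h : hirota (1 : {poly R}) 1 1 1 = 0 by rewrite /hirota !derivE; ring.
by split; rewrite ?lattice00 ?lattice10 ?lattice11 //; apply: regular_poly1.
Qed.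

(** The reflections produce some Y and Z; the Toda identities show that they satisfy the divisions
    defining the first two columns. *)
Lemma column_step k : cell 0 k ->
  (forall k', k = k'.+1 -> down_second 0 k') ->
  [/\ down_first 0 k, down_second 0 k & cell 0 k.+1].
Proof.
rewrite /cell !add0n => t prev.
have nzA := tau_neq0 t; have r1 := tau_rot t; have nzB := tau_neq0 r1.
have r2 := tau_rot r1.
have [Y eY] := reflect_exists r2.
have nPB : 1 + 3 * k%:Z != 0 by lia.
have u := reflect_triple r2 nPB eY; have ru := tau_rot (tau_rot u).
have [Z eZ] := reflect_exists ru.
have YE : Y = lattice 0 k.+1.
  case: k t prev {r1 r2 nPB ru u eZ} nzA nzB eY => [|k] t prev nzA nzB eY.
    move: eY; rewrite lattice00 lattice10 lattice11 lattice01 edge11 mul1r => ->.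
    by rewrite mulrA rt2_double mul_polyC.
  (* Undoing the previous reflection recovers [lattice 0 k], which is opposite to Y about
     [lattice 0 k.+1]. *)
  have e2 := prev _ erefl; rewrite /down_second in e2.
  have nPC : 1 - 3 * (k.+1)%:Z != 0 by lia.
  have v := reflect_triple t nPC _; rewrite mulrC in e2; have {}v := v _ e2.
  rewrite mulrC in e2; rewrite lattice_col0.
  apply: divp_of_mul; first exact: tau_neq0 (tau_rot (tau_rot v)).
  by rewrite (toda_backward v e2 eY); congr (todaRHS _%:~R _); lia.
have ZE : Z = lattice 1 k.+2.
  rewrite lattice_col1; apply: divp_of_mul => //.
  by rewrite (toda_backward r2 eY eZ); congr (todaRHS _%:~R _); lia.
subst Y Z.
have nPA : 1 + 3 * 0%:Z + (1 + 3 * k%:Z) != 0 by lia.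
split=> //; apply: tau_cast (reflect_triple ru nPA eZ) _ _ _; lia.
Qed.

Lemma column_cell k : cell 0 k /\ (forall k', k = k'.+1 -> down_second 0 k').
Proof.
elim: k => [|k [t prev]]; first by split=> //; exact: cell00.
by have [_ d2 t'] := column_step t prev; split=> // _ [<-].
Qed.

Definition lattice_column i := forall k,
  [/\ cell i k, down_first i (i + k) & down_second i (i + k)].

(** With j = i + k, these two reflections carry [cell i k] to [cell i.+1 k]: first Q_{m-1,n} is
    replaced by Q_{m+1,n-1}, then Q_{m,n} by Q_{m+1,n-2}. *)
Definition right_first i j := lattice i j * lattice i.+2 j.+1 =
  rt2 * edge (lattice i.+1 j) (lattice i.+1 j.+1).

Definition right_second i j := lattice i.+1 j * lattice i.+2 j.+2 =
  rt2 * edge (lattice i.+1 j.+1) (lattice i.+2 j.+1).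

Lemma lattice_column0 : lattice_column 0.
Proof.
by move=> k; have [t prev] := column_cell k; have [d1 d2 _] := column_step t prev.
Qed.

(** The reflected vertex and [lattice i (i + k).+1] are opposite about Q_{m,n-1}, which is the
    recurrence along a row. *)
Lemma lattice_right_first i k : lattice_column i -> right_first i (i + k).
Proof.
case/(_ k); rewrite /cell /down_first /down_second => t d1 d2.
have r1 := tau_rot t; have r2 := tau_rot r1.
have nPB : 1 + 3 * k%:Z != 0 by lia.
have u := reflect_triple r2 nPB d1.
have [X eX] := reflect_exists r1.
suff XE : X = lattice i.+2 (i + k).+1 by rewrite /right_first -XE.
rewrite lattice_row; apply: divp_of_mul; first exact: tau_neq0 (tau_rot (tau_rot u)).
rewrite mulrC in d1.
by rewrite (toda_backward u d1 eX); congr (todaRHS _%:~R _); lia.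
Qed.

Lemma lattice_right_second i k : lattice_column i -> right_second i (i + k).
Proof.
move=> col; have f := lattice_right_first k col; have f' := lattice_right_first k.+1 col.
case: (col k); rewrite /cell /down_first /down_second => t d1 d2.
rewrite /right_first addnS in f f'.
have r1 := tau_rot t; have r2 := tau_rot r1.
have nPA : 1 + 3 * i%:Z != 0 by lia.
have nPB : 1 + 3 * k%:Z != 0 by lia.
have nzA := tau_neq0 t.
have u := reflect_triple r2 nPB d1.
have v := reflect_triple r1 nPA f.
have [V eV] := reflect_exists (tau_rot v).
suff VE : V = lattice i.+2 (i + k).+2 by rewrite /right_second -VE.
(* Both candidates are opposite to Q_{m-1,n} about Q_{m,n-1}: one is reached by two reflections to
   the right, the other by going down first. Both products are the same Toda expression. *)
apply: (mulfI nzA); rewrite (toda_forward r2 f eV) (toda_forward u d2 f').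
by congr (todaRHS _%:~R _); lia.
Qed.

Lemma lattice_column_step i : lattice_column i -> lattice_column i.+1.
Proof.
move=> col k; have f := lattice_right_first k col.
have s := lattice_right_second k col; have s' := lattice_right_second k.+1 col.
case: (col k); rewrite /cell /down_first /down_second => t d1 d2.
rewrite /right_first /right_second addnS in f s s'.
have r1 := tau_rot t; have r2 := tau_rot r1.
have nPA : 1 + 3 * i%:Z != 0 by lia.
have nPB : 1 + 3 * k%:Z + (1 + 3 * i%:Z) != 0 by lia.
have nzB := tau_neq0 r1.
have v := reflect_triple r1 nPA f.
have w := reflect_triple (tau_rot v) nPB s.
(* The second downward reflection of the new column is exactly [s']; the cell and the first
   reflection remain. *)
rewrite addSn; split=> //.
  by apply: tau_cast w _ _ _; lia.
have [W eW] := reflect_exists (tau_rot (tau_rot w)).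
suff -> : lattice i.+1 (i + k).+2 = W by [].
(* W and [lattice i.+1 (i + k).+2] are both opposite to Q_{m,n} about Q_{m,n-1}. *)
apply: (mulfI nzB).
rewrite (toda_backward r2 d1 d2) (toda_backward (tau_rot v) s eW).
by congr (todaRHS _%:~R _); lia.
Qed.

Lemma lattice_all i : lattice_column i.
Proof. by elim: i => [|i IH]; [exact: lattice_column0 | exact: lattice_column_step]. Qed.

End Lattice.

(** * Signature words *)

Section TriangleWords.
Variable R : rcfType.
Implicit Types (A B C D : {poly R}) (x : R) (l : R -> sing) (la lb lc ld : sing).

(** The fallback [ld] labels the roots of D, the only roots of A B C D left after the three
    tests. *)
Definition label la lb lc ld A B C x : sing :=
  if A.[x] == 0 then la else if B.[x] == 0 then lb
  else if C.[x] == 0 then lc else ld.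

Definition triangle_word la lb lc A B C :=
  word (label la lb lc lc A B C) (A * B * C).

Definition quad_word la lb lc ld A B C D :=
  word (label la lb lc ld A B C) (A * B * C * D).

Lemma eq_word l l' (H : {poly R}) : H != 0 ->
  (forall x, H.[x] = 0 -> l x = l' x) -> word l H = word l' H.
Proof.
move=> nz e; apply/eq_in_map => x; rewrite mem_rootsR // => /eqP; exact: e.
Qed.

Lemma triangle_word_rot la lb lc A B C PA PB PC : tau_triple A B C PA PB PC ->
  triangle_word la lb lc A B C = triangle_word lb lc la B C A.
Proof.
move=> t; have r1 := tau_rot t; have r2 := tau_rot r1.
rewrite /triangle_word [B * C * A]mulrC mulrA; apply: eq_word => [|x].
  by rewrite !mulf_neq0 ?(tau_neq0 t) ?(tau_neq0 r1) ?(tau_neq0 r2).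
rewrite !hornerM => /eqP; rewrite !mulf_eq0 -orbA /label => /or3P[] /eqP r.
- by have [_ /negPf-> /negPf->] := tau_root t r; rewrite r eqxx.
- by have [_ _ /negPf->] := tau_root r1 r; rewrite r eqxx.
- by have [_ /negPf-> /negPf->] := tau_root r2 r; rewrite r eqxx.
Qed.

Lemma triangle_word_map (f : sing -> sing) la lb lc A B C :
  map f (triangle_word la lb lc A B C) = triangle_word (f la) (f lb) (f lc) A B C.
Proof.
by rewrite /triangle_word /word -map_comp; apply: eq_map => x; rewrite /label /=; case: (_ == _) => //; case: (_ == _) => //; case: (_ == _).
Qed.

(** One reflection acts on words in two moves: the alternation of signs inserts the letters of D,
    and filtering removes those of C. *)
Lemma quad_wordP la lb lc ld A B C D PA PB PC : tau_triple A B C PA PB PC ->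
  0 < PC -> C * D = rt2 * edge A B -> uniq [:: la; lb; lc; ld] ->
  quad_word la lb lc ld A B C D = interlace ld lb true (triangle_word la lb lc A B C)
  /\ triangle_word la lb ld A B D = [seq s <- quad_word la lb lc ld A B C D | s != lc].
Proof.
move=> t pP e; rewrite /= !inE !negb_or -!andbA.
case/and5P=> ab ac ad bc /andP[bd /andP[cd _]].
have nP : PC != 0 by rewrite gt_eqF.
have rr x := reflect_root x t nP e; have t' := reflect_triple t nP e.
have nz : A * B * C * D != 0.
  by rewrite !mulf_neq0 ?(tau_neq0 t) ?(tau_neq0 (tau_rot t))
     ?(tau_neq0 (tau_rot (tau_rot t))) ?(tau_neq0 (tau_rot (tau_rot t'))).
have nz3 : A * B * C != 0 by apply: contraNneq nz => ->; rewrite mul0r.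
pose l := label la lb lc ld A B C.
have lA x : A.[x] = 0 -> l x = la by move=> r; rewrite /l /label r eqxx.
have lB x : B.[x] = 0 -> l x = lb.
  by move=> r; have [_ /(_ r)[/negPf a _ _ _] _ _] := rr x; rewrite /l /label a r eqxx.
have lC x : C.[x] = 0 -> l x = lc.
  move=> r; have [_ _ /(_ r)[/negPf a /negPf b _ _] _] := rr x.
  by rewrite /l /label a b r eqxx.
have lD x : D.[x] = 0 -> l x = ld.
  move=> r; have [_ _ _ /(_ r)[/negPf a /negPf b /negPf c _]] := rr x.
  by rewrite /l /label a b c.
split.
  have hA x : A.[x] = 0 -> (l x != ld) && (l x != lb) by move=> /lA ->; rewrite ad ab.
  have hC x : C.[x] = 0 -> (l x != ld) && (l x != lb).
    by move=> /lC ->; rewrite cd eq_sym bc.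
  have gh : ld != lb by rewrite eq_sym.
  rewrite /quad_word -/l (reflect_word t pP e gh hA lB hC lD).1.
  congr (interlace _ _ _ _); apply: eq_word => // x; rewrite !hornerM => /eqP.
  rewrite !mulf_eq0 -orbA => /or3P[] /eqP r.
  - by rewrite (lA x r) /label r eqxx.
  - by rewrite (lB x r) /label r eqxx; have [_ /(_ r)[/negPf-> _ _ _] _ _] := rr x.
  - rewrite (lC x r) /label r eqxx.
    by have [_ _ /(_ r)[/negPf-> /negPf-> _ _] _] := rr x.
have nz' : A * B * D * C != 0 by rewrite mulrAC.
transitivity (word l (A * B * D)).
  apply: eq_word => [|x]; first by apply: contraNneq nz' => ->; rewrite mul0r.
  rewrite !hornerM => /eqP; rewrite !mulf_eq0 -orbA => /or3P[] /eqP r.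
  - by rewrite (lA x r) /label r eqxx.
  - by rewrite (lB x r) /label r eqxx; have [_ /(_ r)[/negPf-> _ _ _] _ _] := rr x.
  - rewrite (lD x r) /label r eqxx.
    by have [_ _ _ /(_ r)[/negPf-> /negPf-> _ _]] := rr x.
rewrite /quad_word -/l [A * B * C * D]mulrAC /word (rootsR_filter nz') filter_map; congr map.
apply: eq_in_filter => x; rewrite mem_rootsR //= !rootM /root.
case/orP=> [/orP[/orP[]|]|] /eqP r.
- by rewrite r eqxx (lA x r) ac.
- by rewrite r eqxx (lB x r) orbT bc.
- by rewrite r eqxx (lD x r) !orbT eq_sym cd.
- have [_ _ /(_ r)[/negPf-> /negPf-> _ /negPf->] _] := rr x.
  by rewrite (lC x r) eqxx.
Qed.

(* The roles of the letters change when (m,n) does: a zero of Q_{m,n-1}, of type z_+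
   for q_{m,n}, is of type p_+ for q_{m+1,n-1}, and so on. The zeros of the newly
   inserted Q_{m+1,n-1} (resp. Q_{m-1,n-1}) are provisionally written z_-. *)
Definition relabel_right (s : sing) : sing :=
  match s with zplus => pplus | zminus => pminus | pminus => zminus | pplus => zplus end.

Definition relabel_down (s : sing) : sing :=
  match s with zminus => pplus | zplus => pminus | pplus => zminus | pminus => zplus end.

(** Insert the first new vertex, drop Q_{m-1,n}, rename the letters for the new q, insert the second
    new vertex. Q_{m,n} is kept, since its zeros are now the minus zeros. [down_word] follows the
    same scheme. *)
Definition right_word (v : seq sing) : seq sing :=
  interlace zplus pminus true (map relabel_right
    [seq s <- interlace zminus zplus true v | s != pplus]).

Definition down_word (v : seq sing) : seq sing :=
  interlace zplus pminus true (map relabel_down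
    [seq s <- interlace zminus pplus true v | s != pminus]).

Definition cell_word i k :=
  triangle_word pplus pminus zplus (lattice R i (i + k))
    (lattice R i.+1 (i + k)) (lattice R i.+1 (i + k).+1).

(** The third vertex is Q_{m-1,n+1} as long as 0 < i + k; q_{0,0} is handled by [sig_okamoto00]. *)
Definition sig_word i k :=
  quad_word pplus pminus zminus zplus (lattice R i (i + k))
    (lattice R i.+1 (i + k)) (lattice R i (i + k).-1) (lattice R i.+1 (i + k).+1).

Lemma sig_word_right i k :
  sig_word i.+1 k = right_word (cell_word i k) /\
  cell_word i.+1 k = [seq s <- sig_word i.+1 k | s != zminus].
Proof.
have [t _ _] := lattice_all R i k; rewrite /cell in t.
have f := lattice_right_first k (lattice_all R i).
have s := lattice_right_second k (lattice_all R i).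
rewrite /right_first /right_second in f s.
have r1 := tau_rot t.
have pA : 0 < 1 + 3 * i%:Z by lia.
have pB : 0 < 1 + 3 * k%:Z + (1 + 3 * i%:Z) by lia.
have v := tau_rot (reflect_triple r1 (lt0r_neq0 pA) f).
have [V1 T1] := @quad_wordP pminus zplus pplus zminus _ _ _ _ _ _ _ r1 pA f isT.
have [V2 T2] := @quad_wordP pplus pminus zminus zplus _ _ _ _ _ _ _ v pB s isT.
rewrite /sig_word /cell_word addSn /= V2 T2 V2; split=> //.
rewrite /right_word; congr (interlace _ _ _ _).
rewrite (triangle_word_rot _ _ _ t) -V1 -T1 triangle_word_map /=.
by rewrite -(triangle_word_rot _ _ _ (tau_rot (tau_rot v))).
Qed.

Lemma sig_word_down k :
  sig_word 0 k.+1 = down_word (cell_word 0 k) /\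
  cell_word 0 k.+1 = [seq s <- sig_word 0 k.+1 | s != zminus].
Proof.
have [t f s] := lattice_all R 0 k; rewrite /cell in t.
rewrite /down_first /down_second in f s.
have r1 := tau_rot t; have r2 := tau_rot r1.
have pA : 0 < 1 + 3 * 0%:Z + (1 + 3 * k%:Z) by lia.
have pB : 0 < 1 + 3 * k%:Z by lia.
have v := tau_rot (tau_rot (reflect_triple r2 (lt0r_neq0 pB) f)).
have [V1 T1] := @quad_wordP zplus pplus pminus zminus _ _ _ _ _ _ _ r2 pB f isT.
have [V2 T2] := @quad_wordP pplus pminus zminus zplus _ _ _ _ _ _ _ v pA s isT.
rewrite /sig_word /cell_word !add0n /= V2 T2 V2; split=> //.
rewrite /down_word; congr (interlace _ _ _ _).
rewrite (triangle_word_rot _ _ _ t) (triangle_word_rot _ _ _ r1) -V1 -T1.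
by rewrite triangle_word_map (triangle_word_rot _ _ _ v).
Qed.

Lemma cell_word00 : cell_word 0 0 = [::].
Proof.
by rewrite /cell_word /triangle_word lattice00 lattice10 lattice11 !mulr1
  /word -polyC1 rootsRC.
Qed.

End TriangleWords.

(** * Calculus of periodic words *)

Lemma wpowS w k : wpow w k.+1 = w ++ wpow w k. Proof. by []. Qed.

Lemma size_wpow w k : size (wpow w k) = (k * size w)%N.
Proof. by elim: k => //= k IH; rewrite wpowS size_cat IH mulSn. Qed.

Lemma filter_wpow (p : pred sing) w k : filter p (wpow w k) = wpow (filter p w) k.
Proof. by elim: k => //= k IH; rewrite !wpowS filter_cat IH. Qed.

Lemma map_wpow (f : sing -> sing) w k : map f (wpow w k) = wpow (map f w) k.
Proof. by elim: k => //= k IH; rewrite !wpowS map_cat IH. Qed.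

(** A period after which [interlace] is back in the state [b] can be processed any number of
    times. *)
Lemma interlace_wpow g h b u u' k v :
  (forall w, interlace g h b (u ++ w) = u' ++ interlace g h b w) ->
  interlace g h b (wpow u k ++ v) = wpow u' k ++ interlace g h b v.
Proof. by move=> e; elim: k => //= k IH; rewrite !wpowS -!catA e IH. Qed.

Lemma wpow_shift x u k v : wpow (x :: u) k ++ x :: v = x :: wpow (rcons u x) k ++ v.
Proof. by elim: k => //= k IH; rewrite !wpowS -catA IH -cats1 -!catA. Qed.

Lemma wpow_comm w k v : w ++ wpow w k ++ v = wpow w k ++ w ++ v.
Proof. by elim: k => //= k IH; rewrite !wpowS -catA IH -!catA. Qed.

Lemma wpowSr w k : wpow w k.+1 = wpow w k ++ w.
Proof. by have := wpow_comm w k [::]; rewrite !cats0. Qed.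

(** Exhibits the central letter of an alternating word of odd length, where the hat goes. *)
Lemma wpow_double a b k v : wpow [:: a; b] (2 * k) ++ a :: v =
  wpow [:: a; b] k ++ a :: wpow [:: b; a] k ++ v.
Proof.
rewrite mul2n -addnn -(wpow_shift a [:: b]).
by elim: k => // k IH; rewrite addSn addnS !wpowS -!catA IH /= -!(wpow_comm [:: a; b]).
Qed.

Local Notation zp := zplus. Local Notation zm := zminus.
Local Notation pp := pplus. Local Notation pm := pminus.

Lemma interlace_pending g h x u k : x != h ->
  interlace g h true (wpow (x :: u) k) = g :: interlace g h false (wpow (x :: u) k).
Proof. by move=> xh; case: k => [//|k]; rewrite wpowS /= xh. Qed.

(** Turns [cell_word R 0 (2 * v)] into [sig_word R 0 (2 * v).+1]; the three lemmas that follow do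
    the same for the other parity and for steps to the right. *)
Lemma down_word_even v :
  down_word (wpow [:: zp; pp; pm] v ++ wpow [:: pm; pp; zp] v) =
  wpow [:: zp; pp; pm; zm] v ++ [:: zp; pp; zp] ++ wpow [:: zm; pm; pp; zp] v.
Proof.
rewrite /down_word (interlace_wpow (u' := [:: zm; zp; pp; pm])) //.
rewrite -[wpow [:: pm; _; _] v]cats0 (interlace_wpow (u' := [:: zm; pm; pp; zp])) //.
rewrite !filter_cat !map_cat !filter_wpow !map_wpow /= (wpow_shift pp [:: zm; pm]) /=.
rewrite (interlace_wpow (u' := [:: zp; pp; pm; zm])) //=.
by rewrite (interlace_wpow (u' := [:: zp; zm; pm; pp])) //= (wpow_shift zp [:: zm; pm; pp]) cats0.
Qed.

Lemma down_word_odd v :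
  down_word (wpow [:: zp; pp; pm] v ++ [:: zp; pp; zp] ++ wpow [:: pm; pp; zp] v) =
  wpow [:: zp; pp; pm; zm] v.+1 ++ [:: pm; pp; zp] ++ wpow [:: zm; pm; pp; zp] v.
Proof.
rewrite wpowSr /down_word (interlace_wpow (u' := [:: zm; zp; pp; pm])) //=.
rewrite -[wpow [:: pm; _; _] v]cats0 (interlace_wpow (u' := [:: zm; pm; pp; zp])) //.
rewrite filter_cat map_cat /= filter_cat map_cat !filter_wpow !map_wpow /=.
rewrite (interlace_wpow (u' := [:: zp; pp; pm; zm])) //=.
rewrite (interlace_wpow (u' := [:: pp; zp; zm; pm])) //= (wpow_shift pp [:: zp; zm; pm]) /= (wpow_shift zp [:: zm; pm; pp]) cats0.
by rewrite -catA.
Qed.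

Lemma right_word_even m v :
  right_word (wpow [:: zp; pp; pm] v ++ wpow [:: pm] m ++ wpow [:: pm; pp; zp] v) =
  wpow [:: zp; pp; pm; zm] v ++ wpow [:: pm; zm] m ++ [:: pm] ++ wpow [:: zm; pm; pp; zp] v.
Proof.
rewrite /right_word (interlace_wpow (u' := [:: zp; pp; zm; pm])) //=.
rewrite (interlace_wpow (u' := [:: zm; pm])) // interlace_pending //.
rewrite -[wpow [:: pm; _; _] v]cats0 (interlace_wpow (u' := [:: pm; zm; pp; zp])) //= cats0.
rewrite !filter_cat !map_cat /= !filter_wpow !map_wpow /=.
rewrite (interlace_wpow (u' := [:: zp; pp; pm; zm])) //=.
rewrite (interlace_wpow (u' := [:: pm; zm])) //=.
congr (_ ++ (_ ++ _ :: _)).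
(* The prefixed letter changes the pending state to [true], which each period preserves; injectivity
   of cons then removes it. *)
have [] : zp :: interlace zp pm false (wpow [:: zm; pm; pp] v)
          = zp :: wpow [:: zm; pm; pp; zp] v; last by [].
rewrite -interlace_pending // -[wpow [:: zm; pm; pp] v]cats0.
by rewrite (interlace_wpow (u' := [:: zp; zm; pm; pp])) //= (wpow_shift zp [:: zm; pm; pp]) cats0.
Qed.

Lemma right_word_odd m v :
  right_word (wpow [:: zp; pp; pm] v ++ wpow [:: zp; pp] m ++ [:: zp] ++ wpow [:: pm; pp; zp] v) =
  wpow [:: zp; pp; pm; zm] v ++ wpow [:: zp; pp] m.+1 ++ [:: zp] ++ wpow [:: zm; pm; pp; zp] v.
Proof.
rewrite wpowSr /right_word (interlace_wpow (u' := [:: zp; pp; zm; pm])) //=.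
rewrite (interlace_wpow (u' := [:: zp; pp])) //=.
rewrite -[wpow [:: pm; _; _] v]cats0 (interlace_wpow (u' := [:: pm; zm; pp; zp])) //= cats0.
rewrite !filter_cat !map_cat /= !filter_wpow !map_wpow /=.
rewrite (interlace_wpow (u' := [:: zp; pp; pm; zm])) //=.
rewrite (interlace_wpow (u' := [:: zp; pp])) //=.
rewrite -[wpow [:: zm; pm; pp] v]cats0 (interlace_wpow (u' := [:: zp; zm; pm; pp])) //=.
by rewrite (wpow_shift zp [:: zm; pm; pp]) cats0 -!catA.
Qed.

Section ExplicitWords.
Variable R : rcfType.

(** Induction two rows at a time in the first column, and within each row along m. A step to the
    right adds a pair pm zm when k is even and zp pp when k is odd. *)
Lemma cell_word_explicit v :
  [/\ forall m, cell_word R m (2 * v) =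
        wpow [:: zp; pp; pm] v ++ wpow [:: pm] m ++ wpow [:: pm; pp; zp] v,
      forall m, sig_word R m.+1 (2 * v) =
        wpow [:: zp; pp; pm; zm] v ++ wpow [:: pm; zm] m ++ [:: pm] ++ wpow [:: zm; pm; pp; zp] v,
      forall m, sig_word R m (2 * v).+1 =
        wpow [:: zp; pp; pm; zm] v ++ wpow [:: zp; pp] m.+1 ++ [:: zp] ++ wpow [:: zm; pm; pp; zp] v
    & sig_word R 0 (2 * v).+2 =
        wpow [:: zp; pp; pm; zm] v.+1 ++ [:: pm; pp; zp] ++ wpow [:: zm; pm; pp; zp] v].
Proof.
(* One block: the first cell word at k = 2 w determines all words for k = 2 w and 2 w + 1, and the
   first one at 2 w + 2. *)
have next w : cell_word R 0 (2 * w) =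
    wpow [:: zp; pp; pm] w ++ wpow [:: pm; pp; zp] w ->
  [/\ forall m, cell_word R m (2 * w) =
        wpow [:: zp; pp; pm] w ++ wpow [:: pm] m ++ wpow [:: pm; pp; zp] w,
      forall m, sig_word R m.+1 (2 * w) =
        wpow [:: zp; pp; pm; zm] w ++ wpow [:: pm; zm] m ++ [:: pm] ++ wpow [:: zm; pm; pp; zp] w,
      forall m, sig_word R m (2 * w).+1 =
        wpow [:: zp; pp; pm; zm] w ++ wpow [:: zp; pp] m.+1 ++ [:: zp] ++ wpow [:: zm; pm; pp; zp] w
    & sig_word R 0 (2 * w).+2 =
        wpow [:: zp; pp; pm; zm] w.+1 ++ [:: pm; pp; zp] ++ wpow [:: zm; pm; pp; zp] w].
  move=> c0.
  have ev m : cell_word R m (2 * w) =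
      wpow [:: zp; pp; pm] w ++ wpow [:: pm] m ++ wpow [:: pm; pp; zp] w.
    elim: m => // m IH; have [s ->] := sig_word_right R m (2 * w).
    by rewrite wpowSr s IH right_word_even !(filter_cat, filter_wpow) /= -!catA.
  have od m : sig_word R m (2 * w).+1 =
        wpow [:: zp; pp; pm; zm] w ++ wpow [:: zp; pp] m.+1 ++ [:: zp] ++ wpow [:: zm; pm; pp; zp] w
    /\ cell_word R m (2 * w).+1 = [seq s <- sig_word R m (2 * w).+1 | s != zm].
    elim: m => [|m [IH cm]].
      have [s t] := sig_word_down R (2 * w).
      by rewrite t s c0 down_word_even.
    have [s t] := sig_word_right R m (2 * w).+1; split=> //.
    by rewrite s cm IH !(filter_cat, filter_wpow); apply: (right_word_odd m.+1 w).
  split=> //.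
  - by move=> m; have [-> _] := sig_word_right R m (2 * w); rewrite ev right_word_even.
  - by move=> m; have [] := od m.
  have [-> _] := sig_word_down R (2 * w).+1; have [s ->] := od 0%N.
  by rewrite s !(filter_cat, filter_wpow); apply: down_word_odd.
elim: v => [|v [_ _ _ s]]; apply: next; first by rewrite cell_word00.
have [_] := sig_word_down R (2 * v).+1.
have -> : (2 * v.+1 = (2 * v).+2)%N by rewrite mulnS.
by move=> ->; rewrite s !(filter_cat, filter_wpow).
Qed.

End ExplicitWords.

(** * Zeros and poles of q_{m,n} *)

Section Signature.
Variable R : rcfType.
Implicit Types (A B C D F N H : {poly R}) (x : R).

Lemma mup_regular F x : F.[x] != 0 ->
  mup x F = 0%N /\ (F %/ ('X - x%:P) ^+ mup x F).[x] = F.[x].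
Proof. by move=> nr; rewrite mupNroot // expr0 divp1. Qed.

Lemma mup_simple F x : F.[x] = 0 -> F^`().[x] != 0 ->
  mup x F = 1%N /\ (F %/ ('X - x%:P) ^+ mup x F).[x] = F^`().[x].
Proof.
move=> /eqP/factor_root[K eF]; rewrite eF deriv_factor => nK.
have m1 : mup x (('X - x%:P) * K) = 1%N.
  rewrite mupMl //; have := mup_XsubCX 1 x x.
  by rewrite expr1 eqxx.
by rewrite m1 expr1 mulKp ?polyXsubC_eq0.
Qed.

Lemma rootsR_opp H : (exists b : bool, H \Po - 'X = (-1) ^+ b * H) ->
  rootsR H = rev [seq - x | x <- rootsR H].
Proof.
case=> b eH; have [->|nz] := eqVneq H 0; first by rewrite rootsR0.
apply: (irr_sorted_eq lt_trans ltxx (sorted_rootsR H)).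
  rewrite rev_sorted sorted_map; apply: sub_sorted (sorted_rootsR H) => x y /=.
  by rewrite ltrN2.
have e x : root H (- x) = root H x.
  rewrite /root; have := congr1 (fun p => p.[x]) eH.
  rewrite /= horner_comp hornerN hornerX => ->; rewrite hornerM.
  by case: (b); rewrite ?expr1 ?expr0 ?hornerN hornerC ?mulN1r ?mul1r ?oppr_eq0.
move=> x; rewrite mem_rev mem_rootsR // -e -mem_rootsR //.
by rewrite -[in RHS](opprK x) mem_map //; apply: oppr_inj.
Qed.

(** At roots of A and B the edge reduces to -3 A' B and 3 A B', giving residues 1 and -1. At roots
    of Z and Y the derivative of Z Y and the Wronskian give slopes -2 a1 and 2 a1, since PZ = -3
    a1. *)
Lemma signature_of_word A B Z Y PA PB PZ (a1 : R) N pre s0 post :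
  tau_triple A B Z PA PB PZ -> PZ != 0 -> Z * Y = rt2 * edge A B ->
  PZ%:~R = - (3%:R * a1) -> 3%:R * N = - edge A B ->
  quad_word pplus pminus zminus zplus A B Z Y = pre ++ s0 :: post ->
  size pre = size post ->
  signature_is a1 N (A * B) pre s0 post.
Proof.
move=> t nP e ea eN ew es.
have t' := reflect_triple t nP e.
have rr x := reflect_root x t nP e.
have w := reflect_wronskian t e.
set H := A * B * Z * Y.
have nz : H != 0.
  by rewrite !mulf_neq0 ?(tau_neq0 t) ?(tau_neq0 (tau_rot t))
     ?(tau_neq0 (tau_rot (tau_rot t))) ?(tau_neq0 (tau_rot (tau_rot t'))).
have [c c0 rE] := rt2_unit R.
have wx x : Z.[x] * Y^`().[x] - Z^`().[x] * Y.[x] =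
            2%:R * c * PZ%:~R * A.[x] * B.[x].
  have := congr1 (fun p => p.[x]) w.
  by rewrite rE -(rmorph_int (@polyC R)) -polyC_natr !hornerE.
have ex x : Z.[x] * Y.[x] = c * (edge A B).[x].
  by have := congr1 (fun p => p.[x]) e; rewrite rE !hornerE.
have ex' x : Z^`().[x] * Y.[x] + Z.[x] * Y^`().[x] = c * (edge A B)^`().[x].
  have := congr1 (fun p => p^`().[x]) e.
  by rewrite rE !derivE !hornerE /=.
have Nx x : 3%:R * N.[x] = - (edge A B).[x].
  by have := congr1 (fun p => p.[x]) eN; rewrite -polyC_natr !hornerE.
have Nx' x : 3%:R * N^`().[x] = - (edge A B)^`().[x].
  have := congr1 (fun p => p^`().[x]) eN.
  by rewrite -polyC_natr !derivE !hornerE.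
have typ x : [/\
    A.[x] = 0 -> rord N (A * B) x = -1 /\ rlc N (A * B) x = 1,
    B.[x] = 0 -> rord N (A * B) x = -1 /\ rlc N (A * B) x = -1,
    Z.[x] = 0 -> rord N (A * B) x = 1 /\ rlc N (A * B) x = - (2%:R * a1)
  & Y.[x] = 0 -> rord N (A * B) x = 1 /\ rlc N (A * B) x = 2%:R * a1].
  have [rA rB rZ rY] := rr x; rewrite /rord /rlc.
  have D0 : (A * B).[x] = A.[x] * B.[x] by rewrite hornerM.
  have D1 : (A * B)^`().[x] = A^`().[x] * B.[x] + A.[x] * B^`().[x].
    by rewrite derivM hornerD !hornerM.
  split=> r.
  - have [a b _ _] := rA r.
    have eE : N.[x] = A^`().[x] * B.[x].
      by apply: (@mulfI _ 3%:R); rewrite ?pnatr_eq0 // Nx edgeE r; ring.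
    have nN : N.[x] != 0 by rewrite eE mulf_neq0.
    rewrite r mul0r in D0; rewrite r mul0r addr0 in D1.
    have nD : (A * B)^`().[x] != 0 by rewrite D1 mulf_neq0.
    have [-> ->] := mup_regular nN; have [-> ->] := mup_simple D0 nD.
    by rewrite D1 eE divff ?mulf_neq0.
  - have [a b _ _] := rB r.
    have eE : N.[x] = - (A.[x] * B^`().[x]).
      by apply: (@mulfI _ 3%:R); rewrite ?pnatr_eq0 // Nx edgeE r; ring.
    have nN : N.[x] != 0 by rewrite eE oppr_eq0 mulf_neq0.
    rewrite r mulr0 in D0; rewrite r mulr0 add0r in D1.
    have nD : (A * B)^`().[x] != 0 by rewrite D1 mulf_neq0.
    have [-> ->] := mup_regular nN; have [-> ->] := mup_simple D0 nD.
    by rewrite D1 eE mulNr divff ?mulf_neq0.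
  - have [a b _ _] := rZ r.
    have N0 : N.[x] = 0.
      apply: (@mulfI _ 3%:R); rewrite ?pnatr_eq0 // mulr0 Nx.
      by apply/eqP; rewrite oppr_eq0 -(mulrI_eq0 _ (mulfI (lt0r_neq0 c0))) -ex r mul0r.
    have N1 : N^`().[x] = - (2%:R * a1) * (A.[x] * B.[x]).
      apply: (@mulfI _ (3%:R * c)); first by rewrite mulf_neq0 ?pnatr_eq0 ?lt0r_neq0.
      rewrite mulrAC Nx' mulNr [X in - X = _]mulrC -ex' r mul0r addr0.
      have := wx x; rewrite r mul0r sub0r ea => ->; ring.
    have nD : (A * B).[x] != 0 by rewrite D0 mulf_neq0.
    have nN : N^`().[x] != 0.
      rewrite N1 !mulf_neq0 // oppr_eq0 mulf_neq0 ?pnatr_eq0 //.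
      apply: contraNneq nP => a10; move: ea; rewrite a10 mulr0 oppr0 => /eqP.
      by rewrite intr_eq0.
    have [-> ->] := mup_simple N0 nN; have [-> ->] := mup_regular nD.
    by rewrite N1 D0 mulfK ?mulf_neq0.
  have [a b _ _] := rY r.
  have N0 : N.[x] = 0.
    apply: (@mulfI _ 3%:R); rewrite ?pnatr_eq0 // mulr0 Nx.
    by apply/eqP; rewrite oppr_eq0 -(mulrI_eq0 _ (mulfI (lt0r_neq0 c0))) -ex r mulr0.
  have N1 : N^`().[x] = (2%:R * a1) * (A.[x] * B.[x]).
    apply: (@mulfI _ (3%:R * c)); first by rewrite mulf_neq0 ?pnatr_eq0 ?lt0r_neq0.
    rewrite mulrAC Nx' mulNr [X in - X = _]mulrC -ex' r mulr0 add0r.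
    have := wx x; rewrite r mulr0 subr0 ea => ->; ring.
  have nD : (A * B).[x] != 0 by rewrite D0 mulf_neq0.
  have nN : N^`().[x] != 0.
    rewrite N1 !mulf_neq0 ?pnatr_eq0 //.
    apply: contraNneq nP => a10; move: ea; rewrite a10 mulr0 oppr0 => /eqP.
    by rewrite intr_eq0.
  have [-> ->] := mup_simple N0 nN; have [-> ->] := mup_regular nD.
  by rewrite N1 D0 mulfK ?mulf_neq0.
have szts : size (rootsR H) = size (pre ++ s0 :: post).
  by rewrite -ew /quad_word /word size_map.
exists (rootsR H); split=> //.
- exact: sorted_rootsR.
- move=> x; rewrite mem_rootsR // /H !rootM -!orbA /root.
  have [tA tB tZ tY] := typ x.
  case: eqVneq => [/tA[-> _]|nA] //=; case: eqVneq => [/tB[-> _]|nB] //=.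
  case: eqVneq => [/tZ[-> _]|nZ] //=; case: eqVneq => [/tY[-> _]|nY] //=.
  rewrite /rord; have nD : (A * B).[x] != 0 by rewrite hornerM mulf_neq0.
  have nN : N.[x] != 0.
    apply: contraNneq (mulf_neq0 nZ nY) => N0; have := Nx x.
    by rewrite ex N0 mulr0 => /esym/eqP; rewrite oppr_eq0 => /eqP->; rewrite mulr0.
  by have [-> _] := mup_regular nN; have [-> _] := mup_regular nD.
- move=> i; rewrite -szts => lt_i.
  rewrite -ew /quad_word /word (nth_map 0) // -/H.
  have := mem_nth 0 lt_i; move: (nth 0 _ i) => x; rewrite mem_rootsR // /H !rootM -!orbA /root.
  have [tA tB tZ tY] := typ x; rewrite /label.
  case: eqVneq => [/tA|nA] //=; case: eqVneq => [/tB|nB] //=.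
  by case: eqVneq => [/tZ|nZ] //= /eqP/tY.
have sym : exists b : bool, H \Po - 'X = (-1) ^+ b * H.
  have [_ _ _ _ [_ _ [bA eA]] [_ _ [bB eB]] [_ _ [bZ eZ]]] := t.
  have [_ _ _ _ _ _ [_ _ [bY eY]]] := t'.
  exists (bA (+) bB (+) bZ (+) bY); rewrite /H !comp_polyM eA eB eZ eY.
  by case: (bA) (bB) (bZ) (bY) => [] [] [] []; rewrite /= ?expr0 ?expr1; ring.
have sz2 : size (rootsR H) = (size pre + (size pre).+1)%N.
  by rewrite szts size_cat /= -es.
(* The root list is symmetric and [size pre] is its middle index, so this root equals its own
   negative. *)
have mid : nth 0 (rootsR H) (size pre) = - nth 0 (rootsR H) (size pre).
  rewrite {1}(rootsR_opp sym) nth_rev; last by rewrite size_map sz2; lia.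
  rewrite size_map (nth_map 0); last by rewrite sz2; lia.
  by congr (- nth _ _ _); rewrite sz2; lia.
by lra.
Qed.

Lemma okamotoQ_lattice (i j : nat) : okamotoQ R i%:Z (- j%:Z) = lattice R i.+1 j.
Proof. by rewrite /okamotoQ /= abszN. Qed.

Lemma okamotoQ_lattice_pred (i j : nat) : okamotoQ R (i%:Z - 1) (- j%:Z) = lattice R i j.
Proof.
case: i => [|i]; first by rewrite /okamotoQ sub0r /= abszN.
by rewrite -okamotoQ_lattice; congr okamotoQ; lia.
Qed.

Lemma qnum_edge (m n : int) :
  3%:R * qnum R m n = - edge (okamotoQ R (m - 1) n) (okamotoQ R m n).
Proof.
rewrite /qnum /qden /edge -mul_polyC.
set A := okamotoQ _ _ _; set B := okamotoQ _ _ _.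
have e : 3%:R * (2%:R / 3%:R)%:P = 2%:R :> {poly R}.
  by rewrite -!polyC_natr -polyCM; congr _%:P; field.
transitivity (- (3%:R * (2%:R / 3%:R)%:P * 'X * A * B)
   + 3%:R * (A^`() * B - B^`() * A)); first by ring.
by rewrite e; ring.
Qed.

Lemma sig_okamoto_of_word (i k : nat) pre s0 post : (0 < i + k)%N ->
  sig_word R i k = pre ++ s0 :: post -> size pre = size post ->
  sig_okamoto R i%:Z (- (i + k)%:Z) pre s0 post.
Proof.
move=> ik ew es; rewrite /sig_okamoto /qden okamotoQ_lattice okamotoQ_lattice_pred.
have [t _ _] := lattice_all R i k; rewrite /cell in t.
(* Q_{m,n-1} reflects back to Q_{m-1,n+1}: this is the last reflection down the first column, or the
   last one to the right when i is positive. *)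
have e : lattice R i.+1 (i + k).+1 * lattice R i (i + k).-1
       = rt2 * edge (lattice R i (i + k)) (lattice R i.+1 (i + k)).
  case: i ik {t ew} => [|i] ik.
    case: k ik => // k _; have [_ _] := lattice_all R 0 k.
    by rewrite /down_second !add0n mulrC.
  have := lattice_right_second k (lattice_all R i).
  by rewrite /right_second addSn mulrC.
have nP : 1 - 3 * (i + k)%:Z != 0 by lia.
have t' := reflect_triple t nP e; rewrite mulrC in e.
apply: signature_of_word t' _ e _ _ ew es; first by rewrite oppr_eq0.
  by rewrite /okA1; field.
by rewrite qnum_edge okamotoQ_lattice okamotoQ_lattice_pred.
Qed.

End Signature.

(** * The six cases, named by the parities of m and m + n *)

Section Cases.
Variable R : rcfType.

Lemma sig_okamoto00 : sig_okamoto R 0 0 [::] zminus [::].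
Proof.
have t := cell00 R; rewrite /cell lattice00 lattice10 lattice11 in t.
have t1 : tau_triple (1 : {poly R}) 1 1 1 1 1 by apply: tau_cast t _ _ _.
(* D stands for Q_{-1,1}, outside the range of [lattice]; its single root yields the letter of
   q_{0,0}. *)
have [D eD] := reflect_exists t1.
have t2 := reflect_triple t1 isT eD.
have o0 : okamotoQ R 0 0 = 1 by [].
have o1 : okamotoQ R (0 - 1) 0 = 1 by [].
rewrite /sig_okamoto /qden o0 o1.
apply: (signature_of_word (Y := 1) t2 _ _ _ _ _ erefl) => //.
- by rewrite mulrC.
- by rewrite /okA1; field.
- by rewrite qnum_edge o0 o1.
have [V _] := @quad_wordP _ pplus pminus zplus zminus _ _ _ _ _ _ _ t1 isT eD isT.
have T0 : triangle_word pplus pminus zplus (1 : {poly R}) 1 1 = [::].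
  by rewrite /triangle_word !mulr1 /word -polyC1 rootsRC.
rewrite T0 /= in V; rewrite cat0s -V /quad_word !mulr1 !mul1r.
apply: eq_word; first exact: tau_neq0 (tau_rot (tau_rot t2)).
by move=> x r; rewrite /label r eqxx !hornerE oner_eq0.
Qed.

Lemma sig_okamoto_even_even mu nu : (1 <= mu)%N ->
  sig_okamoto R (2 * mu)%N%:Z (- (2 * mu + 2 * nu)%N%:Z)
    (wpow [:: zplus; pplus; pminus; zminus] nu
       ++ wpow [:: pminus; zminus] mu.-1 ++ [:: pminus])
    zminus
    (pminus :: wpow [:: zminus; pminus] mu.-1
       ++ wpow [:: zminus; pminus; pplus; zplus] nu).
Proof.
case: mu => // mu _; apply: sig_okamoto_of_word; first by lia.
  have [_ s _ _] := cell_word_explicit R nu.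
  have -> : (2 * mu.+1 = (2 * mu).+2)%N by lia.
  rewrite s wpowSr -!catA; congr (_ ++ _).
  (* The exponent is odd: one pair is set apart so that [wpow_double] applies, and the centre is the
     zminus after the middle pminus. *)
  rewrite -[[:: pminus; zminus] ++ _]/(pminus :: [:: zminus; pminus] ++ _).
  by rewrite wpow_double -wpow_comm.
by rewrite /= !(size_cat, size_wpow) /=; lia.
Qed.

(** For positive mu this is the previous word regrouped, one long period being opened on each side
    of the centre; mu = 0 needs the separate first-column formula. *)
Lemma sig_okamoto_even_even' mu nu : (1 <= nu)%N ->
  sig_okamoto R (2 * mu)%N%:Z (- (2 * mu + 2 * nu)%N%:Z)
    (wpow [:: zplus; pplus; pminus; zminus] nu.-1
       ++ [:: zplus; pplus] ++ wpow [:: pminus; zminus] mu ++ [:: pminus])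
    zminus
    (pminus :: wpow [:: zminus; pminus] mu ++ [:: pplus; zplus]
       ++ wpow [:: zminus; pminus; pplus; zplus] nu.-1).
Proof.
case: mu => [|mu] nu_gt0.
  case: nu nu_gt0 => // nu _; apply: sig_okamoto_of_word; first by lia.
    have [_ _ _ s] := cell_word_explicit R nu.
    have -> : (2 * nu.+1 = (2 * nu).+2)%N by lia.
    by rewrite muln0 s wpowSr -!catA.
  by rewrite /= !(size_cat, size_wpow) /=; lia.
have := @sig_okamoto_even_even mu.+1 nu isT.
case: nu nu_gt0 => // nu _.
rewrite [in wpow [:: zplus; _; _; _] nu.+1]wpowSr [in wpow [:: zminus; pminus] mu.+1]wpowSr.
by rewrite /= -!catA.
Qed.

Lemma sig_okamoto_even_odd mu nu :
  sig_okamoto R (2 * mu)%N%:Z (- (2 * mu + (2 * nu).+1)%N%:Z)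
    (wpow [:: zplus; pplus; pminus; zminus] nu
       ++ wpow [:: zplus; pplus] mu ++ [:: zplus])
    pplus
    (zplus :: wpow [:: pplus; zplus] mu
       ++ wpow [:: zminus; pminus; pplus; zplus] nu).
Proof.
apply: sig_okamoto_of_word; first by lia.
  have [_ _ s _] := cell_word_explicit R nu.
  rewrite s wpowSr -!catA; congr (_ ++ _).
  rewrite -[[:: zplus; pplus] ++ _]/(zplus :: [:: pplus; zplus] ++ _).
  by rewrite wpow_double -wpow_comm.
by rewrite /= !(size_cat, size_wpow) /=; lia.
Qed.

Lemma sig_okamoto_odd_odd mu nu : (1 <= nu)%N ->
  sig_okamoto R (2 * mu + 1)%N%:Z (- (2 * mu + 1 + (2 * nu).-1)%N%:Z)
    (wpow [:: zplus; pplus; pminus; zminus] nu.-1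
       ++ wpow [:: zplus; pplus] mu.+1)
    zplus
    (wpow [:: pplus; zplus] mu.+1
       ++ wpow [:: zminus; pminus; pplus; zplus] nu.-1).
Proof.
case: nu => // nu _; apply: sig_okamoto_of_word; first by lia.
  have [_ _ s _] := cell_word_explicit R nu.
  have -> : ((2 * nu.+1).-1 = (2 * nu).+1)%N by lia.
  have e : ((2 * mu + 1).+1 = 2 * mu.+1)%N by lia.
  by rewrite s e cat1s wpow_double -catA.
by rewrite !(size_cat, size_wpow) /=; lia.
Qed.

Lemma sig_okamoto_odd_even mu nu :
  sig_okamoto R (2 * mu + 1)%N%:Z (- (2 * mu + 1 + 2 * nu)%N%:Z)
    (wpow [:: zplus; pplus; pminus; zminus] nu
       ++ wpow [:: pminus; zminus] mu)
    pminus
    (wpow [:: zminus; pminus] mu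
       ++ wpow [:: zminus; pminus; pplus; zplus] nu).
Proof.
apply: sig_okamoto_of_word; first by lia.
  have [_ s _ _] := cell_word_explicit R nu.
  by rewrite addn1 s cat1s wpow_double -catA.
by rewrite !(size_cat, size_wpow) /=; lia.
Qed.

End Cases.

Theorem mainTheorem5 (R : rcfType) (m n : int) :
  0 <= m -> m + n <= 0 ->
  (m = 0 -> n = 0 -> sig_okamoto R m n [::] zminus [::]) /\
   (forall mu nu : nat, (1 <= mu)%N ->
      m = (2 * mu)%N -> n = - (2 * mu)%N%:Z - (2 * nu)%N%:Z ->
      sig_okamoto R m n
        (wpow [:: zplus; pplus; pminus; zminus] nu
           ++ wpow [:: pminus; zminus] mu.-1 ++ [:: pminus])
        zminus
        (pminus :: wpow [:: zminus; pminus] mu.-1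
           ++ wpow [:: zminus; pminus; pplus; zplus] nu)) /\
   (forall mu nu : nat, (1 <= nu)%N ->
      m = (2 * mu)%N -> n = - (2 * mu)%N%:Z - (2 * nu)%N%:Z ->
      sig_okamoto R m n
        (wpow [:: zplus; pplus; pminus; zminus] nu.-1
           ++ [:: zplus; pplus] ++ wpow [:: pminus; zminus] mu ++ [:: pminus])
        zminus
        (pminus :: wpow [:: zminus; pminus] mu ++ [:: pplus; zplus]
           ++ wpow [:: zminus; pminus; pplus; zplus] nu.-1)) /\
   (forall mu nu : nat,
      m = (2 * mu)%N -> n = - (2 * mu)%N%:Z - (2 * nu)%N%:Z - 1 ->
      sig_okamoto R m n
        (wpow [:: zplus; pplus; pminus; zminus] nu
           ++ wpow [:: zplus; pplus] mu ++ [:: zplus])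
        pplus
        (zplus :: wpow [:: pplus; zplus] mu
           ++ wpow [:: zminus; pminus; pplus; zplus] nu)) /\
   (forall mu nu : nat,
      m = (2 * mu + 1)%N -> n = - (2 * mu)%N%:Z - (2 * nu)%N%:Z ->
      sig_okamoto R m n
        (wpow [:: zplus; pplus; pminus; zminus] nu.-1
           ++ wpow [:: zplus; pplus] mu.+1)
        zplus
        (wpow [:: pplus; zplus] mu.+1
           ++ wpow [:: zminus; pminus; pplus; zplus] nu.-1)) /\
   (forall mu nu : nat,
      m = (2 * mu + 1)%N -> n = - (2 * mu)%N%:Z - (2 * nu)%N%:Z - 1 ->
      sig_okamoto R m n
        (wpow [:: zplus; pplus; pminus; zminus] nu
           ++ wpow [:: pminus; zminus] mu)
        pminus
        (wpow [:: zminus; pminus] mu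
           ++ wpow [:: zminus; pminus; pplus; zplus] nu)).
Proof.
move=> m_ge0 mn_le0; split; last split; last split; last split; last split.
- by move=> -> ->; exact: sig_okamoto00.
- move=> mu nu h -> nE; have -> : n = - (2 * mu + 2 * nu)%N%:Z by lia.
  exact: sig_okamoto_even_even.
- move=> mu nu h -> nE; have -> : n = - (2 * mu + 2 * nu)%N%:Z by lia.
  exact: sig_okamoto_even_even'.
- move=> mu nu -> nE; have -> : n = - (2 * mu + (2 * nu).+1)%N%:Z by lia.
  exact: sig_okamoto_even_odd.
(* Here m + n = 1 - 2 nu, so m + n <= 0 excludes nu = 0. *)
- move=> mu nu mE nE; have nu_gt0 : (1 <= nu)%N by lia.
  rewrite mE; have -> : n = - (2 * mu + 1 + (2 * nu).-1)%N%:Z by lia.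
  exact: sig_okamoto_odd_odd.
move=> mu nu -> nE; have -> : n = - (2 * mu + 1 + 2 * nu)%N%:Z by lia.
exact: sig_okamoto_odd_even.
Qed.
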